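(* For every $\alpha\in\mathbb R$ with $\alpha\neq0$, the Riemannian manifold $(\mathrm{Sym}_{++}(n),g^{(\alpha)})$ has nonnegative sectional curvature; that is, for every $P\in\mathrm{Sym}_{++}(n)$ and every two-dimensional subspace $\sigma$ of the tangent space at $P$, the sectional curvature of $\sigma$ at $P$ with respect to the Alpha-Procrustes metric $g^{(\alpha)}$ is $\ge0$.
   Context: $\mathrm{Sym}_{++}(n)$ is the manifold of real symmetric positive definite $n\times n$ matrices, with each tangent space identified with the space $\mathrm{Sym}(n)$ of real symmetric matrices. Real powers, $\log$ and $\exp$ of matrices are defined by spectral calculus, and $(Df)(A)[E]$ denotes the Fréchet derivative of $f$ at $A$ in direction $E$. Alpha-Procrustes metric: for $P\in\mathrm{Sym}_{++}(n)$, $\alpha\in\mathbb R$ and $Y\in\mathrm{Sym}(n)$, $\mathcal L_{P,\alpha}(Y)$ is the unique $H\in\mathrm{Sym}(n)$ with $$(D\exp)(\log P)\circ(D\log)(P^{2\alpha})[HP^{2\alpha}+P^{2\alpha}H]=Y,$$ and $g^{(\alpha)}_P(X,Y)=4\,\mathrm{tr}\big(\mathcal L_{P,\alpha}(X)\,P^{2\alpha}\,\mathcal L_{P,\alpha}(Y)\big)$ for $X,Y\in\mathrm{Sym}(n)$. The sectional curvature of $\sigma=\mathrm{span}\{u,v\}$ at $p$ for a Riemannian metric $g$ is $\dfrac{g_p(R_p(u,v)v,u)}{g_p(u,u)g_p(v,v)-g_p(u,v)^2}$, where $R$ is the Riemann curvature tensor of $g$ (with the sign convention for which round spheres have positive sectional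 curvature). *)

(* Defs.v *)
From HB Require Import structures.
From mathcomp Require Import all_boot all_order all_algebra.
From mathcomp Require Import all_classical all_reals all_analysis.

Set Implicit Arguments.
Unset Strict Implicit.
Unset Printing Implicit Defensive.

Import Order.TTheory GRing.Theory Num.Theory.
Import numFieldNormedType.Exports.

Local Open Scope classical_set_scope.
Local Open Scope ring_scope.

Section RiemannChart.

(* Riemannian geometry in a single chart: the manifold is an open subset of V,
   all its tangent spaces are identified with V, and vector fields are functions
   V -> V.  Only the germs at the point of evaluation of the metric and of the
   vector fields matter, so their values outside the manifold are irrelevant. *)

Context {R : realType} {V : normedModType R}.
Implicit Types (g : V -> V -> V -> R) (X Y Z : V -> V) (p u v w : V).

Definition lie_bracket X Y : V -> V := fun p => 'D_(X p) Y p - 'D_(Y p) X p.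

(* The right-hand side of Koszul's formula for 2 g(nabla_X Y, Z) at p. *)
Definition koszul g X Y Z p : R :=
  'D_(X p) (fun q => g q (Y q) (Z q)) p
  + 'D_(Y p) (fun q => g q (Z q) (X q)) p
  - 'D_(Z p) (fun q => g q (X q) (Y q)) p
  + g p (lie_bracket X Y p) (Z p)
  - g p (lie_bracket Y Z p) (X p)
  + g p (lie_bracket Z X p) (Y p).

(* The Levi-Civita connection of g.  Both sides of Koszul's formula are
   tensorial in Z, hence testing against constant fields suffices. *)
Definition levi_civita g X Y : V -> V := fun p =>
  xget 0 [set W | forall z, 2 * g p W z = koszul g X Y (cst z) p].

Definition curvature_field g X Y Z : V -> V := fun p =>
  levi_civita g X (levi_civita g Y Z) p
  - levi_civita g Y (levi_civita g X Z) p
  - levi_civita g (lie_bracket X Y) Z p.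

(* The curvature tensor at p, through the constant extensions of its
   arguments. *)
Definition riemann_tensor g p u v w : V :=
  curvature_field g (cst u) (cst v) (cst w) p.

Definition sectional_curvature g p u v : R :=
  g p (riemann_tensor g p u v v) u / (g p u u * g p v v - g p u v ^+ 2).

End RiemannChart.

Section SymmetricMatrices.
Context (R : realType) (n : nat).

Definition symspace : {vspace 'M[R]_n} :=
  lker (linfun (@trmx R n n) - \1)%VF.

Lemma symspaceP (A : 'M[R]_n) : reflect (A^T = A) (A \in symspace).
Proof.
by apply: (iffP eqlfunP); rewrite lfunE /= id_lfunE.
Qed.

Definition sym : Type := subvs_of symspace.

HB.instance Definition _ := GRing.SubLmodule.on sym.
HB.instance Definition _ := Vector.on sym.

Definition sym_norm (A : sym) : R := `|vsval A|.

Lemma ler_sym_normD (A B : sym) : sym_norm (A + B) <= sym_norm A + sym_norm B.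
Proof. by rewrite /sym_norm linearD /= ler_normD. Qed.

Lemma sym_normZ (a : R) (A : sym) : sym_norm (a *: A) = `|a| * sym_norm A.
Proof. by rewrite /sym_norm linearZ /= normrZ. Qed.

Lemma sym_norm_eq0 (A : sym) : sym_norm A = 0 -> A = 0.
Proof. by move=> /eqP; rewrite normr_eq0 => /eqP A0; apply/val_inj. Qed.

HB.instance Definition _ :=
  Lmodule_isNormed.Build R sym ler_sym_normD sym_normZ sym_norm_eq0.

Definition sympd : set sym :=
  [set P | forall x : 'rV[R]_n, x != 0 -> 0 < (x *m val P *m x^T) 0 0].

Lemma anticomm_subproof (A B : sym) :
  val A *m val B + val B *m val A \in symspace.
Proof.
have /symspaceP tA := valP A; have /symspaceP tB := valP B.
by apply/symspaceP; rewrite linearD /= !trmx_mul tA tB addrC.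
Qed.

Definition anticomm (A B : sym) : sym := Subvs (anticomm_subproof A B).

(* f(A) = U^T diag(f(d_1), ..., f(d_n)) U for any orthogonal diagonalization
   A = U^T diag(d_1, ..., d_n) U; the value does not depend on the choice of
   the diagonalization. *)
Definition spectral_fun (f : R -> R) (A : sym) : sym :=
  xget 0 [set B | exists (U : 'M[R]_n) (d : 'rV[R]_n),
    [/\ U *m U^T = 1%:M, val A = U^T *m diag_mx d *m U &
        val B = U^T *m diag_mx (map_mx f d) *m U]].

(* On symmetric matrices that are not positive definite, symlog and sympow
   take junk values. *)
Definition symexp : sym -> sym := spectral_fun expR.
Definition symlog : sym -> sym := spectral_fun (@ln R).
Definition sympow (P : sym) (a : R) : sym := spectral_fun (fun x => x `^ a) P.

Definition procrustes_L (a : R) (P Y : sym) : sym :=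
  xget 0 [set H | 'd symexp (symlog P)
    ('d symlog (sympow P (2 * a)) (anticomm H (sympow P (2 * a)))) = Y].

Definition alpha_procrustes (a : R) (P X Y : sym) : R :=
  4 * \tr (val (procrustes_L a P X) *m val (sympow P (2 * a))
           *m val (procrustes_L a P Y)).

End SymmetricMatrices.

(* Main.v *)
Require Import Defs.
From HB Require Import structures.
From mathcomp Require Import all_boot all_order all_algebra.
From mathcomp Require Import complex.
From mathcomp Require Import all_classical all_reals all_analysis.
From mathcomp Require Import ring lra.
Import Order.TTheory GRing.Theory Num.Theory.
Import numFieldNormedType.Exports.
Local Open Scope classical_set_scope.
Local Open Scope ring_scope.

Set Implicit Arguments.
Unset Strict Implicit.
Unset Printing Implicit Defensive.

(** Let [Q q = q ^ (2 alpha)] and [Q0 = Q P].  Let [T q] be the optimal transport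
    map from [Q0] to [Q q], i.e. the positive definite solution of
    [T Q0 T = Q q], and let [K x] solve [K x * Q + Q * K x = D_x Q].  Then
    [g_q(x, y) = <K x * T, K y * T>] for the constant inner product
    [<A, B> = alpha^-2 tr (A Q0 B^T)], and the difference [N x = D_x T - K x * T]
    is orthogonal to all [K y * T].  Hence [g_q(x, y) = <D_x T, D_y T> - <N x, N y>]:
    a flat metric minus a square.  The square vanishes at [P], so it only enters
    the curvature at [P] through its second derivatives; these are given by
    [D_u (N v)], which is skew in [u, v] at [P], and the numerator of the
    sectional curvature is [3 <D_u (N v), D_u (N v)>].

    Everything is smooth because the matrix exponential is, its directional
    derivative being a block of the exponential of a block matrix, and because
    the logarithm is a locally Lipschitz inverse of the exponential. *)

(** * Functions of class [C^k] on an open set *)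

(** Behind the construction stands the Riemannian submersion [M -> M Q0 M^T] on invertible matrices
    with the flat metric [<A, B>]. The map [T] is a section of it over the image of [Q], [K x * T]
    is the horizontal lift of [D_x Q], and [N x] is the vertical part of [D_x T]: differentiating
    [T Q0 T = Q q] shows that [N x * Q0 * T] is skew, hence trace-orthogonal to the symmetric [K y].
    The result is an instance of O'Neill's formula, obtained here from one explicit section instead
    of quotient geometry. At [P] one has [T = 1], so [N x] is a symmetric solution of a homogeneous
    Lyapunov equation, hence zero; the same equation for [D_u (N v) + D_v (N u)] gives the skewness.
    The flat part cancels because [D_u D_v T] at [P] lies in the range of [D T]. The factor 3
    collects one square from each of the three second derivatives of the metric in the curvature
    formula. The obstacle is regularity: the metric and the connection are given by choice, so they
    are first characterised by uniquely solvable linear equations, whose solutions depend smoothly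
    on the point. *)

Section Differentials.
Context {R : realType}.
Implicit Types V W : normedModType R.

Lemma differentiable_littleo V W (f : V -> W) (L : {linear V -> W}) x :
  continuous L ->
  (forall e, 0 < e -> \forall h \near 0, `|f (h + x) - (f x + L h)| <= e * `|h|) ->
  differentiable f x /\ 'd f x = L :> (V -> W).
Proof.
move=> cL fL.
have fo : f \o shift x = cst (f x) + L +o_ 0 id by apply/eqaddoP => e e0; exact: fL.
have dL := diff_unique cL fo.
by split => //; apply/diff_locallyP; rewrite dL.
Qed.

Lemma differentiable_bound V W (f : V -> W) x : differentiable f x ->
  forall e, 0 < e -> \forall h \near 0, `|f (h + x) - (f x + 'd f x h)| <= e * `|h|.
Proof. by move=> /diff_locally /eqaddoP H e e0; exact: H. Qed.

Lemma differentiable_quadratic V W (f : V -> W) (L : {linear V -> W}) x C :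
  continuous L ->
  (\forall h \near 0, `|f (h + x) - (f x + L h)| <= C * `|h| ^+ 2) ->
  differentiable f x /\ 'd f x = L :> (V -> W).
Proof.
move=> cL fL; apply: differentiable_littleo => // e e0.
have k0 : 0 < (`|C| + 1)^-1 * e by rewrite mulr_gt0 ?invr_gt0 ?ltr_wpDl.
near=> h.
have /le_trans-> // : `|f (h + x) - (f x + L h)| <= C * `|h| ^+ 2 by near: h.
have hk : `|h| <= (`|C| + 1)^-1 * e.
  by near: h; exact: nbhs0_le.
rewrite expr2 mulrA ler_wpM2r//.
rewrite (le_trans (ler_wpM2r _ (ler_norm C)))//.
rewrite (le_trans (ler_wpM2l _ hk))// mulrA ler_piMl ?(ltW e0)//.
by rewrite ler_pdivrMr ?mul1r ?lerDl ?ltr_wpDl.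
Unshelve. all: by end_near. Qed.

Lemma near_eq_differentiable V W (f g : V -> W) x :
  (\forall y \near x, f y = g y) -> differentiable f x -> differentiable g x.
Proof.
move=> fg df.
apply: (differentiable_littleo (L := 'd f x) _ _).1.
  exact: diff_continuous.
move=> e e0.
have fg' : \forall h \near 0, f (h + x) = g (h + x).
  have := near_shift 0 x (fun y => f y = g y).
  by rewrite subr0 => <-.
near=> h.
rewrite -(near fg' h)// -(nbhs_singleton fg).
near: h; exact: differentiable_bound.
Unshelve. all: by end_near. Qed.
End Differentials.

Section ContinuouslyDifferentiable.
Context {R : realType}.

(** Derivatives are taken in constant directions, so each of them is again a function [V -> W] and
    inductions on [k] never leave that type. In finite dimension this is the usual class C^k. *)
Fixpoint Ck (V W : normedModType R) (k : nat) (U : set V) (f : V -> W) : Prop :=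
  if k is k'.+1 then
    (forall q, U q -> differentiable f q) /\
    (forall v, Ck k' U (fun q => 'D_v f q))
  else forall q, U q -> {for q, continuous f}.

Definition smooth (V W : normedModType R) (U : set V) (f : V -> W) :=
  forall k, Ck k U f.

Definition coordinates (V : normedModType R) m (e : 'I_m -> V)
    (c : 'I_m -> {linear V -> R}) :=
  [/\ forall i, continuous (c i), forall i j, c i (e j) = (i == j)%:R
    & forall x, x = \sum_i c i x *: e i].

Section Closure.
Variables (V : normedModType R) (U : set V).
Hypothesis oU : open U.
Implicit Types (W X : normedModType R) (k : nat).

Lemma open_near (P : set V) q : U q -> (forall x, U x -> P x) -> \forall x \near q, P x.
Proof. by move=> Uq UP; apply: filterS UP _; exact: open_nbhs_nbhs. Qed.

Lemma Ck_eq W k (f g : V -> W) : (forall q, U q -> f q = g q) ->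
  Ck k U f -> Ck k U g.
Proof.
elim: k => [|k IH] in f g *.
  move=> fg cf q Uq; rewrite /prop_for /continuous_at -(fg q Uq).
  apply: cvg_trans (cf q Uq); apply: near_eq_cvg.
  by apply: open_near => // x Ux; rewrite fg.
move=> fg [df Df]; split=> [q Uq|v].
  by apply: near_eq_differentiable (df q Uq); exact: open_near.
apply: IH (Df v) => q Uq; apply: near_eq_derive; exact: open_near.
Qed.

Lemma Ck_pred W k (f : V -> W) : Ck k.+1 U f -> Ck k U f.
Proof.
elim: k => [|k IH] in f *.
  by move=> [df _] q Uq; apply: differentiable_continuous; exact: df.
by move=> [df Df]; split => // v; exact: IH (Df v).
Qed.

Lemma Ck_cst W k (a : W) : Ck k U (fun=> a).
Proof.
elim: k => [|k IH] in a *; first by move=> q _; exact: cst_continuous.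
split=> [q _|v]; first exact: differentiable_cst.
by apply: Ck_eq (IH 0) => q _; rewrite derive_cst.
Qed.

Lemma CkD W k (f g : V -> W) : Ck k U f -> Ck k U g ->
  Ck k U (fun q => f q + g q).
Proof.
elim: k => [|k IH] in f g *.
  by move=> cf cg q Uq; apply: continuousD; [exact: cf|exact: cg].
move=> [df Df] [dg Dg]; split=> [q Uq|v].
  by apply: differentiableD; [exact: df|exact: dg].
apply: Ck_eq (IH _ _ (Df v) (Dg v)) => q Uq.
by rewrite -deriveD //; apply: diff_derivable; [exact: df|exact: dg].
Qed.

Lemma Ck_sum W k (I : Type) (r : seq I) (P : pred I) (f : I -> V -> W) :
  (forall i, P i -> Ck k U (f i)) -> Ck k U (fun q => \sum_(i <- r | P i) f i q).
Proof.
move=> cf; elim: r => [|i r IH].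
  by under eq_fun do rewrite big_nil; exact: Ck_cst.
case Pi : (P i); last first.
  by apply: Ck_eq IH => q _; rewrite big_cons Pi.
by apply: Ck_eq (CkD (cf i Pi) IH) => q _; rewrite big_cons Pi.
Qed.

Lemma Ck_linear W X k (L : {linear W -> X}) (f : V -> W) : continuous L ->
  Ck k U f -> Ck k U (fun q => L (f q)).
Proof.
move=> cL; elim: k => [|k IH] in f *.
  by move=> cf q Uq; apply: (continuous_comp (cf q Uq)); exact: cL.
move=> [df Df]; have dL x : differentiable L x by exact: linear_differentiable.
split=> [q Uq|v]; first by apply: (differentiable_comp (df q Uq)).
apply: Ck_eq (IH _ (Df v)) => q Uq.
rewrite !deriveE; [|exact: differentiable_comp (df q Uq) _|exact: df].
by rewrite (diff_comp (df q Uq))//= diff_lin.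
Qed.

Lemma derive_bilinear (W1 W2 X : normedModType R) (b : {bilinear W1 -> W2 -> X}) (f : V -> W1)
    (g : V -> W2) q : continuous (fun p => b p.1 p.2) ->
  differentiable f q -> differentiable g q ->
  differentiable (fun x => b (f x) (g x)) q /\
  forall v, 'D_v (fun x => b (f x) (g x)) q = b (f q) ('D_v g q) + b ('D_v f q) (g q).
Proof.
move=> cb df dg.
have dfg := differentiable_pair df dg.
have db := differentiable_bilin (f q, g q) cb.
have dc := differentiable_comp dfg db.
split=> // v; rewrite deriveE // (diff_comp dfg db) /= (diff_pair df dg) diff_bilin//=.
by rewrite !deriveE.
Qed.

Lemma Ck_bilinear (W1 W2 X : normedModType R) k (b : {bilinear W1 -> W2 -> X}) (f : V -> W1)
    (g : V -> W2) : continuous (fun p => b p.1 p.2) ->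
  Ck k U f -> Ck k U g -> Ck k U (fun q => b (f q) (g q)).
Proof.
move=> cb; elim: k => [|k IH] in f g *.
  move=> cf cg q Uq; apply: (@continuous_comp _ _ _ (fun q => (f q, g q)) (fun p => b p.1 p.2)).
    by apply: cvg_pair; [exact: cf|exact: cg].
  exact: cb.
move=> Hf Hg; have [df Df] := Hf; have [dg Dg] := Hg.
split=> [q Uq|v].
  by have [] := derive_bilinear cb (df _ Uq) (dg _ Uq).
apply: Ck_eq (CkD (IH _ _ (Ck_pred Hf) (Dg v)) (IH _ _ (Df v) (Ck_pred Hg))) => q Uq.
by have [_ ->] := derive_bilinear cb (df _ Uq) (dg _ Uq).
Qed.

Lemma Ck_affine W X k (U' : set W) (f : W -> X) (a : W) (L : {linear V -> W}) :
  continuous L -> (forall q, U q -> U' (a + L q)) ->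
  Ck k U' f -> Ck k U (fun q => f (a + L q)).
Proof.
move=> cL UU'.
have dA q : differentiable (cst a + L) q.
  by apply: differentiableD; [exact: differentiable_cst|exact: linear_differentiable].
elim: k => [|k IH] in f *.
  move=> cf q Uq; apply: (continuous_comp (differentiable_continuous (dA q))).
  exact: cf (UU' _ Uq).
move=> [df Df]; split=> [q Uq|v].
  exact: (differentiable_comp (dA q) (df _ (UU' _ Uq))).
apply: Ck_eq (IH _ (Df (L v))) => q Uq.
have dfq := df _ (UU' _ Uq).
rewrite deriveE // [in RHS]deriveE; last exact: (differentiable_comp (dA q) dfq).
rewrite (diff_comp (dA q) dfq)/= diffD ?diff_cst ?diff_lin//=; last exact: linear_differentiable.
by rewrite add0r.
Qed.

End Closure.
End ContinuouslyDifferentiable.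

(** * Products, linear systems and compositions of C^k functions in coordinates *)

Fact scaler_is_bilinear (R : comNzRingType) (W : lmodType R) : bilinear_for
  (GRing.Scale.Law.clone _ _ *:%R _) (GRing.Scale.Law.clone _ _ *:%R _)
  (@GRing.scale R W : R^o -> W -> W).
Proof.
split=> [u'|u] a x y /=; first by rewrite scalerDl scalerA.
by rewrite scalerDr !scalerA mulrC.
Qed.

Section Coordinates.
Context {R : realType} {V : normedModType R} {m : nat}.
Variables (e : 'I_m -> V) (c : 'I_m -> {linear V -> R}).
Hypothesis ec : coordinates e c.

Lemma coord_basis_sum (a : 'I_m -> R) i : c i (\sum_j a j *: e j) = a i.
Proof.
have [_ ce _] := ec; rewrite linear_sum (bigD1 i)//= linearZ/= ce eqxx.
rewrite [_ *: _]mulr1 big1 ?addr0// => j ji.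
by rewrite linearZ/= ce eq_sym (negbTE ji) scaler0.
Qed.

Lemma coord_inj x y : (forall i, c i x = c i y) -> x = y.
Proof.
by move=> cxy; have [_ _ E] := ec; rewrite [x]E [y]E; apply: eq_bigr => i _; rewrite cxy.
Qed.

End Coordinates.

Section Algebra.
Context {R : realType}.
Variables (V : normedModType R) (U : set V).
Hypothesis oU : open U.
Implicit Types (W X : normedModType R) (k : nat).

Lemma CkN W k (f : V -> W) : Ck k U f -> Ck k U (fun q => - f q).
Proof. by apply: (Ck_linear oU (L := -%R)) => x; exact: opp_continuous. Qed.

Lemma CkB W k (f g : V -> W) : Ck k U f -> Ck k U g -> Ck k U (fun q => f q - g q).
Proof. by move=> cf cg; apply: CkD => //; exact: CkN. Qed.

Lemma Ck_scale W k (r : V -> R) (f : V -> W) : Ck k U r -> Ck k U f ->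
  Ck k U (fun q => r q *: f q).
Proof.
pose bM := bilinear_isBilinear.Build _ _ _ _ _ _ _ (@scaler_is_bilinear R W).
pose b : {bilinear R^o -> W -> W} := HB.pack (@GRing.scale R W) bM.
by apply: (@Ck_bilinear _ _ _ oU _ _ _ k b) => x; exact: scale_continuous.
Qed.

Lemma CkM k (f g : V -> R) : Ck k U f -> Ck k U g -> Ck k U (fun q => f q * g q).
Proof. by apply: (@Ck_bilinear _ _ _ oU R R R k *%R) => x; exact: mul_continuous. Qed.

Lemma Ck_prod k (I : Type) (r : seq I) (P : pred I) (f : I -> V -> R) :
  (forall i, P i -> Ck k U (f i)) -> Ck k U (fun q => \prod_(i <- r | P i) f i q).
Proof.
move=> cf; elim: r => [|i r IH].
  by under eq_fun do rewrite big_nil; exact: Ck_cst.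
case Pi : (P i); last first.
  by apply: (Ck_eq _ _ IH) => // q _; rewrite big_cons Pi.
by apply: (Ck_eq _ _ (CkM (cf i Pi) IH)) => // q _; rewrite big_cons Pi.
Qed.

Lemma CkV k (f : V -> R) : (forall q, U q -> f q != 0) -> Ck k U f ->
  Ck k U (fun q => (f q)^-1).
Proof.
move=> f0; elim: k => [|k IH] in f f0 *.
  by move=> cf q Uq; apply: continuousV; [exact: f0|exact: cf].
move=> Hf; have [df Df] := Hf; split=> [q Uq|v].
  by apply: differentiableV; [exact: df|exact: f0].
have cV := IH _ f0 (Ck_pred Hf).
apply: (Ck_eq oU _ (CkN (CkM (CkM cV cV) (Df v)))) => q Uq.
by rewrite deriveV ?f0 //; [rewrite -expr2 exprVn scaleNr|apply: diff_derivable; exact: df].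
Qed.

Lemma Ck_det k m (M : V -> 'M[R]_m) : (forall i j, Ck k U (fun q => M q i j)) ->
  Ck k U (fun q => \det (M q)).
Proof.
move=> cM; apply: Ck_sum => // s _; apply: CkM; first exact: Ck_cst.
by apply: Ck_prod.
Qed.

Definition coord_mx W m (e : 'I_m -> W) (c : 'I_m -> {linear W -> R})
  (A : W -> W) : 'M[R]_m := \matrix_(i, j) c i (A (e j)).

Lemma coord_mxP W m (e : 'I_m -> W) (c : 'I_m -> {linear W -> R}) (A : W -> W) w :
  coordinates e c -> linear A ->
  \col_i c i (A w) = coord_mx e c A *m \col_j c j w.
Proof.
move=> [_ _ ec] linA.
pose L : {linear W -> W} := HB.pack A (GRing.isLinear.Build R W W _ A linA).
apply/colP => i; rewrite !mxE -[A w]/(L w) {1}[w]ec !linear_sum; apply: eq_bigr => j _.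
by rewrite !linearZ/= !mxE mulrC.
Qed.

Lemma coord_mx_unit W m (e : 'I_m -> W) (c : 'I_m -> {linear W -> R}) (A : W -> W) :
  coordinates e c -> linear A -> (forall w, A w = 0 -> w = 0) ->
  coord_mx e c A \in unitmx.
Proof.
move=> ec0 linA injA; have [cc ce ec] := ec0.
rewrite -unitmx_tr -row_free_unit; apply/row_freeP.
suff : kermx (coord_mx e c A)^T = 0 by move=> /eqP; rewrite kermx_eq0 => /row_freeP.
apply/eqP/rowV0P => v /sub_kermxP vM.
have vE : \col_j c j (\sum_i v 0 i *: e i) = v^T.
  by apply/colP => j; rewrite [LHS]mxE [RHS]mxE (coord_basis_sum ec0).
have v0 : \sum_i v 0 i *: e i = 0.
  apply: injA; rewrite [LHS]ec big1 // => i _.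
  have /colP/(_ i) := coord_mxP (\sum_i v 0 i *: e i) ec0 linA.
  by rewrite vE -[coord_mx _ _ _]trmxK -trmx_mul vM trmx0 !mxE => ->; rewrite scale0r.
by apply: trmx_inj; rewrite -vE v0; apply/colP => j; rewrite !mxE linear0.
Qed.

Lemma linear_injective_surjective W m (e : 'I_m -> W) (c : 'I_m -> {linear W -> R})
    (A : W -> W) : coordinates e c -> linear A -> (forall w, A w = 0 -> w = 0) ->
  forall y, exists x, A x = y.
Proof.
move=> ec0 linA injA y; have [cc ce ec] := ec0.
have uM := coord_mx_unit ec0 linA injA.
pose z := invmx (coord_mx e c A) *m \col_j c j y.
exists (\sum_i z i 0 *: e i).
have zE : \col_j c j (\sum_i z i 0 *: e i) = z.
  by apply/colP => j; rewrite mxE (coord_basis_sum ec0).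
rewrite [LHS]ec [RHS]ec; apply: eq_bigr => i _; congr (_ *: _).
have /colP/(_ i) := coord_mxP (\sum_i z i 0 *: e i) ec0 linA.
by rewrite zE /z mulmxA mulmxV// mul1mx !mxE.
Qed.

(* Cramer's rule expresses the solution [Y] through determinants. *)
Lemma Ck_solve W m (e : 'I_m -> W) (c : 'I_m -> {linear W -> R}) k
    (A : V -> W -> W) (F Y : V -> W) : coordinates e c ->
  (forall q, U q -> linear (A q)) ->
  (forall q w, U q -> A q w = 0 -> w = 0) ->
  (forall j, Ck k U (fun q => A q (e j))) -> Ck k U F ->
  (forall q, U q -> A q (Y q) = F q) -> Ck k U Y.
Proof.
move=> ec0 linA injA cA cF AY; have [cc ce ec] := ec0.
pose M q := coord_mx e c (A q).
have uM q : U q -> M q \in unitmx.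
  by move=> Uq; apply: coord_mx_unit (linA q Uq) _ => // w; exact: injA.
have cM i j : Ck k U (fun q => M q i j).
  apply: (Ck_eq oU (f := fun q => c i (A q (e j)))) => [q _|]; first by rewrite mxE.
  exact: Ck_linear.
have cAdj i j : Ck k U (fun q => (\adj (M q)) i j).
  apply: (Ck_eq oU (f := fun q => cofactor (M q) j i)) => [q _|]; first by rewrite [RHS]mxE.
  apply: CkM; first exact: Ck_cst.
  apply: Ck_det => i' j'.
  by apply: (Ck_eq oU (f := fun q => M q (lift j i') (lift i j'))) => // q _; rewrite !mxE.
apply: (Ck_eq oU (f := fun q => \sum_i
   ((\det (M q))^-1 * \sum_j (\adj (M q)) i j * c j (F q)) *: e i)) => [q Uq|].
  rewrite [RHS]ec; apply: eq_bigr => i _; congr (_ *: _).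
  have : \col_j c j (Y q) = invmx (M q) *m \col_j c j (F q).
    apply: (canRL (mulKmx (uM q Uq))).
    by rewrite -(coord_mxP (Y q) ec0 (linA q Uq)) AY//.
  move=> /colP/(_ i); rewrite mxE => ->.
  rewrite /invmx uM// -scalemxAl mxE; congr (_ * _).
  rewrite [RHS]mxE; apply: eq_bigr => j _; congr (_ * _).
  by rewrite [RHS]mxE.
apply: Ck_sum => // i _; apply: Ck_scale; last exact: Ck_cst.
apply: CkM.
  apply: CkV; last exact: Ck_det.
  by move=> q Uq; have := uM q Uq; rewrite unitmxE unitfE.
apply: Ck_sum => // j _; apply: CkM => //; exact: Ck_linear.
Qed.

(** The chain rule differentiates [g] in the direction ['D_v f q], which moves with [q]. Expanding
    it in the basis leaves the fixed directions [e i], to which the induction hypothesis applies. *)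
Lemma Ck_comp W X m (e : 'I_m -> W) (c : 'I_m -> {linear W -> R}) k (U' : set W)
    (f : V -> W) (g : W -> X) : coordinates e c ->
  (forall q, U q -> U' (f q)) -> Ck k U f -> Ck k U' g -> Ck k U (fun q => g (f q)).
Proof.
move=> [cc ce ec] UU'; elim: k => [|k IH] in g *.
  move=> cf cg q Uq; apply: (continuous_comp (cf q Uq)); exact: cg (UU' _ Uq).
move=> Hf [dg Dg]; have [df Df] := Hf; split=> [q Uq|v].
  exact: (differentiable_comp (df _ Uq) (dg _ (UU' _ Uq))).
apply: (Ck_eq oU (f := fun q => \sum_i c i ('D_v f q) *: 'D_(e i) g (f q))) => [q Uq|].
  have dfq := df _ Uq; have dgq := dg _ (UU' _ Uq).
  rewrite [RHS]deriveE; last exact: (differentiable_comp dfq dgq).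
  rewrite (diff_comp dfq dgq)/= -(deriveE v dfq) [in RHS](ec ('D_v f q)) linear_sum.
  by apply: eq_bigr => i _; rewrite linearZ/= -deriveE.
apply: Ck_sum => // i _; apply: Ck_scale; first by apply: Ck_linear (Df v).
by apply: IH (Ck_pred Hf) (Dg _).
Qed.

End Algebra.

(** * Symmetry of second derivatives *)

Section MixedDerivatives.
Context {R : realType}.

Lemma is_derive_line (V : normedModType R) (f : V -> R) (a u : V) (s : R) :
  differentiable f (a + s *: u) ->
  is_derive s 1 (fun s => f (a + s *: u)) ('D_u f (a + s *: u)).
Proof.
move=> df.
have dA : differentiable (cst a + (fun s : R => s *: u)) s.
  by apply: differentiableD; exact: ex_diff.
have dc := differentiable_comp dA df.
apply: DeriveDef; first exact: diff_derivable.
rewrite deriveE // (diff_comp dA df)/= deriveE // diffD; [|exact: ex_diff|exact: ex_diff].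
by rewrite !diff_val /= add0r scale1r.
Qed.

(** The mean value theorem is used twice: on the difference of [f] along two parallel segments in
    direction [u], then on ['D_u f] along [v]. *)
Lemma second_difference (V : normedModType R) (U : set V) (f : V -> R) p u v (t : R) :
  Ck 2 U f -> 0 < t ->
  (forall s s', s \in `[0, t] -> s' \in `[0, t] -> U (p + s *: u + s' *: v)) ->
  exists s s', [/\ s \in `[0, t], s' \in `[0, t] &
    f (p + t *: u + t *: v) - f (p + t *: u) - (f (p + t *: v) - f p)
    = t ^+ 2 * 'D_v (fun q => 'D_u f q) (p + s *: u + s' *: v)].
Proof.
move=> [df Df] t0 UP; have [dDu _] := Df u.
have t00 : 0 \in `[0, t] by rewrite in_itv/= lexx ltW.
have tt : t \in `[0, t] by rewrite in_itv/= lexx ltW.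
pose phi s := f (p + t *: v + s *: u) - f (p + s *: u).
have dphi s : s \in `[0, t] ->
    is_derive s 1 phi ('D_u f (p + t *: v + s *: u) - 'D_u f (p + s *: u)).
  move=> st; apply: is_deriveB; apply: is_derive_line; apply: df.
    by rewrite addrAC; exact: UP.
  by rewrite -[_ + _]addr0 -(scale0r v); exact: UP.
have [s1 s1t ->] : exists2 s, s \in `]0, t[%R &
    f (p + t *: u + t *: v) - f (p + t *: u) - (f (p + t *: v) - f p) =
    ('D_u f (p + t *: v + s *: u) - 'D_u f (p + s *: u)) * (t - 0).
  have H1 x : x \in `]0, t[%R ->
      is_derive x 1 phi ('D_u f (p + t *: v + x *: u) - 'D_u f (p + x *: u)).
    by move=> xt; apply: dphi; exact: subset_itv_oo_cc xt.
  have H2 : {within `[0, t], continuous phi}.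
    apply: derivable_within_continuous => x xt.
    exact: (@ex_derive _ _ _ _ _ _ _ (dphi x xt)).
  have [c ct] := MVT t0 H1 H2.
  move=> H; exists c => //; rewrite -H /phi !scale0r !addr0; congr (f _ - _ - _).
  by rewrite addrAC.
have {}s1t : s1 \in `[0, t] by exact: subset_itv_oo_cc s1t.
pose psi s := 'D_u f (p + s1 *: u + s *: v).
have dpsi s : s \in `[0, t] ->
    is_derive s 1 psi ('D_v (fun q => 'D_u f q) (p + s1 *: u + s *: v)).
  by move=> st; apply: is_derive_line; apply: dDu; exact: UP.
have H1 x : x \in `]0, t[%R ->
    is_derive x 1 psi ('D_v (fun q => 'D_u f q) (p + s1 *: u + x *: v)).
  by move=> xt; apply: dpsi; exact: subset_itv_oo_cc xt.
have H2 : {within `[0, t], continuous psi}.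
  apply: derivable_within_continuous => x xt.
  exact: (@ex_derive _ _ _ _ _ _ _ (dpsi x xt)).
have [s2 s2t E] := MVT t0 H1 H2.
exists s1, s2; split=> //; first exact: subset_itv_oo_cc s2t.
move: E; rewrite /psi scale0r addr0 addrAC => ->.
by rewrite subr0 expr2; ring.
Qed.

(** The second difference over a parallelogram is symmetric in [u] and [v], so the two mixed
    derivatives agree at two points close to [p]; continuity brings them to within [e] of each other
    at [p]. *)
Lemma derive_comm (V : normedModType R) (U : set V) (f : V -> R) p u v :
  open U -> Ck 2 U f -> U p ->
  'D_v (fun q => 'D_u f q) p = 'D_u (fun q => 'D_v f q) p.
Proof.
move=> oU cf Up; apply/eqP; rewrite -subr_eq0 -normr_le0; apply/ler_addgt0Pl => e e0.
have [_ Df] := cf.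
have cvu : {for p, continuous (fun q => 'D_v (fun q => 'D_u f q) q)}.
  by have [_ /(_ v) H] := Df u; exact: H.
have cuv : {for p, continuous (fun q => 'D_u (fun q => 'D_v f q) q)}.
  by have [_ /(_ u) H] := Df v; exact: H.
have e2 : 0 < e / 2 by rewrite divr_gt0.
have : \forall q \near p, [/\ U q,
    `|'D_v (fun q => 'D_u f q) p - 'D_v (fun q => 'D_u f q) q| < e / 2 &
    `|'D_u (fun q => 'D_v f q) p - 'D_u (fun q => 'D_v f q) q| < e / 2].
  have N1 : \forall q \near p, U q by apply: open_nbhs_nbhs.
  have N2 : \forall q \near p, `|'D_v (fun q => 'D_u f q) p - 'D_v (fun q => 'D_u f q) q| < e / 2.
    exact: (iffLR (cvgrPdist_lt _ _) cvu _ e2).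
  have N3 : \forall q \near p, `|'D_u (fun q => 'D_v f q) p - 'D_u (fun q => 'D_v f q) q| < e / 2.
    exact: (iffLR (cvgrPdist_lt _ _) cuv _ e2).
  by near=> q; split; [exact: (near N1 q)|exact: (near N2 q)|exact: (near N3 q)].
move=> /nbhs_ballP[r /= r0 Hr].
(* This side length keeps the whole parallelogram in the ball of radius [r]; the [1] makes the
   inclusion strict and the denominator positive. *)
pose t := r / (`|u| + `|v| + 1).
have uv0 : 0 < `|u| + `|v| + 1 by rewrite ltr_wpDl ?addr_ge0.
have t0 : 0 < t by rewrite divr_gt0.
have inball s s' : s \in `[0, t] -> s' \in `[0, t] -> ball p r (p + s *: u + s' *: v).
  rewrite !in_itv/= => /andP[s0 st] /andP[s0' st'].
  rewrite -ball_normE/= -addrA opprD addNKr normrN.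
  rewrite (le_lt_trans (ler_normD _ _))// !normrZ !ger0_norm//.
  have : s * `|u| + s' * `|v| <= t * (`|u| + `|v|).
    by rewrite mulrDr lerD// ler_wpM2r.
  move=> /le_lt_trans; apply; rewrite /t mulrAC ltr_pdivrMr// ltr_pM2l//.
  by rewrite ltrDl.
have [s1 [s1' [hs1 hs1' E1]]] :=
  second_difference cf t0 (fun s s' hs hs' =>
    let: And3 Uq _ _ := Hr _ (inball s s' hs hs') in Uq).
have inball' s s' : s \in `[0, t] -> s' \in `[0, t] -> ball p r (p + s *: v + s' *: u).
  by move=> hs hs'; rewrite addrAC; exact: inball.
have [s2 [s2' [hs2 hs2' E2]]] :=
  second_difference cf t0 (fun s s' hs hs' =>
    let: And3 Uq _ _ := Hr _ (inball' s s' hs hs') in Uq).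
have [_ H1 _] := Hr _ (inball _ _ hs1 hs1').
have [_ _ H2] := Hr _ (inball' _ _ hs2 hs2').
have E : 'D_v (fun q => 'D_u f q) (p + s1 *: u + s1' *: v) =
         'D_u (fun q => 'D_v f q) (p + s2 *: v + s2' *: u).
  apply: (@mulfI _ (t ^+ 2)); first by rewrite expf_neq0 ?gt_eqF.
  have aux (w x y z : R) : w - x - (y - z) = w - y - (x - z) by ring.
  apply: (etrans (esym E1)); apply: etrans E2; rewrite (addrAC p (t *: v)).
  exact: aux.
rewrite addr0 (splitr e); apply: le_trans (ler_distD _ _ _) _; last first.
  by apply: lerD; [exact: ltW H1|rewrite E distrC; exact: ltW H2].
Unshelve. all: by end_near. Qed.

End MixedDerivatives.

(** * Finite dimension: matrix norms and continuity of linear maps *)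

Section FiniteDimension.
Context {R : realType}.

Lemma linear_continuous_mx (W : normedModType R) m n (L : {linear 'M[R]_(m, n) -> W}) :
  continuous L.
Proof.
have -> : (L : _ -> _) = (fun A : 'M[R]_(m, n) => \sum_i \sum_j A i j *: L (delta_mx i j)).
  apply/funext => A; rewrite {1}[A]matrix_sum_delta linear_sum; apply: eq_bigr => i _.
  by rewrite linear_sum; apply: eq_bigr => j _; rewrite linearZ.
suff H : Ck 0 setT (fun A : 'M[R]_(m, n) => \sum_i \sum_j A i j *: L (delta_mx i j)).
  by move=> A; exact: H.
apply: Ck_sum => [|i _]; first exact: openT.
apply: Ck_sum => [|j _]; first exact: openT.
apply: Ck_scale => [||]; [exact: openT| |exact: (Ck_cst openT)].
by move=> q _; exact: coord_continuous.
Qed.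

Lemma mulmx_continuous m n p :
  continuous (fun x : 'M[R]_(m, n) * 'M[R]_(n, p) => x.1 *m x.2).
Proof.
pose T := ('M[R]_(m, n) * 'M[R]_(n, p))%type.
have -> : (fun x : T => x.1 *m x.2) =
  (fun x => \sum_i \sum_k (\sum_j x.1 i j * x.2 j k) *: delta_mx i k).
  apply/funext => x; rewrite {1}[x.1 *m x.2]matrix_sum_delta; apply: eq_bigr => i _.
  by apply: eq_bigr => k _; rewrite mxE.
suff H : Ck 0 setT
    (fun x : T => \sum_i \sum_k (\sum_j x.1 i j * x.2 j k) *: (delta_mx i k : 'M[R]_(m, p))).
  by move=> x; exact: H.
apply: Ck_sum => [|i _]; first exact: openT.
apply: Ck_sum => [|k _]; first exact: openT.
apply: Ck_scale => [||]; [exact: openT| |exact: (Ck_cst openT)].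
apply: Ck_sum => [|j _]; first exact: openT.
apply: CkM => [|q _|q _]; first exact: openT.
- exact: (continuous_comp cvg_fst (@coord_continuous _ _ _ i j q.1)).
- exact: (continuous_comp cvg_snd (@coord_continuous _ _ _ j k q.2)).
Qed.

Lemma mx_norm_entry m n (A : 'M[R]_(m, n)) i j : `|A i j| <= `|A|.
Proof. by rewrite [leRHS]mx_normrE; exact: (le_bigmax _ _ (i, j)). Qed.

Lemma mx_norm_le m n (A : 'M[R]_(m, n)) C : 0 <= C ->
  (forall i j, `|A i j| <= C) -> `|A| <= C.
Proof. by move=> C0 AC; rewrite [leLHS]mx_normrE; apply: bigmax_le => // -[]. Qed.

(** The norm is the largest absolute value of an entry, hence submultiplicative only up to the inner
    dimension. This is the source of the factors [n%:R] in the bounds on the exponential. *)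
Lemma mx_norm_mul m n p (A : 'M[R]_(m, n)) (B : 'M[R]_(n, p)) :
  `|A *m B| <= n%:R * `|A| * `|B|.
Proof.
apply: mx_norm_le => [|i k]; first by rewrite !mulr_ge0.
rewrite mxE (le_trans (ler_norm_sum _ _ _))//.
apply: (@le_trans _ _ (\sum_(j < n) `|A| * `|B|)).
  by apply: ler_sum => j _; rewrite normrM ler_pM ?mx_norm_entry.
by rewrite sumr_const card_ord -mulrA mulr_natl.
Qed.

Variable n : nat.

Lemma val_sym_continuous : continuous (vsval : sym R n -> 'M[R]_n).
Proof.
apply: (@bounded_linear_continuous R (sym R n) _ (vsval : {linear sym R n -> 'M[R]_n})).
apply/linear_boundedP; near=> r => x.
rewrite -[leLHS]/(`|x|) ler_peMl//; near: r; exact: nbhs_pinfty_ge.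
Unshelve. all: by end_near. Qed.

Lemma linear_continuous_sym (W : normedModType R) (L : {linear sym R n -> W}) :
  continuous L.
Proof.
have -> : (L : _ -> _) = (L \o vsproj (symspace R n)) \o vsval.
  by apply/funext => A /=; rewrite vsvalK.
move=> A; apply: continuous_comp; first exact: val_sym_continuous.
exact: linear_continuous_mx.
Qed.

Lemma sym_coordinates : exists m (e : 'I_m -> sym R n) (c : 'I_m -> {linear sym R n -> R}),
  coordinates e c.
Proof.
pose X := vbasis (fullv : {vspace sym R n}).
exists (\dim (fullv : {vspace sym R n})), (fun i => X`_i),
  (fun i => coord X i : {linear sym R n -> R^o}).
have bX : basis_of fullv X := vbasisP _.
split=> [i|i j|x]; first exact: linear_continuous_sym.
  by rewrite /= coord_free ?(basis_free bX)// eq_sym.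
by rewrite /= -(coord_basis bX) ?memvf.
Qed.
End FiniteDimension.

(** * The matrix exponential *)

Section MatrixExponential.
Context {R : realType}.

Definition mexp_sum n (A : 'M[R]_n) m : 'M[R]_n := \sum_(k < m) (k`!%:R)^-1 *: A ^+ k.

(** The limit is taken entrywise, where comparison with the real exponential series applies;
    [cvg_mexp_sum] upgrades it to convergence in norm. *)
Definition mexp n (A : 'M[R]_n) : 'M[R]_n :=
  \matrix_(i, j) limn (fun m => mexp_sum A m i j).

Lemma mx_norm_pow n (A : 'M[R]_n) k : `|A ^+ k| <= (n%:R * `|A|) ^+ k.
Proof.
elim: k => [|k IH].
  rewrite !expr0; apply: mx_norm_le => // i j.
  by rewrite mxE; case: eqP => _; rewrite ?normr1 ?normr0.
rewrite !exprS; apply: le_trans (mx_norm_mul _ _) _.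
by rewrite ler_wpM2l ?mulr_ge0.
Qed.

Lemma mexp_term_le n (A : 'M[R]_n) i j k :
  `|((k`!%:R)^-1 *: A ^+ k) i j| <= exp_coeff (n%:R * `|A|) k.
Proof.
apply: le_trans (mx_norm_entry _ _ _) _.
rewrite normrZ ger0_norm ?invr_ge0// /exp_coeff/= mulrC.
by rewrite ler_wpM2r ?invr_ge0// mx_norm_pow.
Qed.

Lemma mexp_sum_norm n (A : 'M[R]_n) m : `|mexp_sum A m| <= expR (n%:R * `|A|).
Proof.
have x0 : 0 <= n%:R * `|A| by rewrite mulr_ge0.
apply: mx_norm_le => [|i j]; first exact: expR_ge0.
apply: (@le_trans _ _ (series (exp_coeff (n%:R * `|A|)) m)).
  rewrite /mexp_sum summxE (le_trans (ler_norm_sum _ _ _))//.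
  rewrite seriesEord/=; apply: ler_sum => k _; exact: mexp_term_le.
apply: nondecreasing_cvgn_le; last exact: is_cvg_series_exp_coeff.
by apply: nondecreasing_series => k _ _; exact: exp_coeff_ge0.
Qed.

Lemma cvg_mexp_sum n (A : 'M[R]_n) : mexp_sum A m @[m --> \oo] --> mexp A.
Proof.
have cij i j : mexp_sum A m i j @[m --> \oo] --> mexp A i j.
  rewrite mxE.
  have -> : (fun m => mexp_sum A m i j) = series (fun k => ((k`!%:R)^-1 *: A ^+ k) i j).
    by apply/funext => m; rewrite seriesEord/= /mexp_sum summxE.
  apply: normed_cvg.
  apply: (series_le_cvg (v_ := exp_coeff (n%:R * `|A|))) => [k|k|k|].
  - exact: normr_ge0.
  - by rewrite exp_coeff_ge0 ?mulr_ge0.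
  - exact: mexp_term_le.
  - exact: is_cvg_series_exp_coeff.
apply/cvgrPdist_le => e e0.
have : \forall m \near \oo, forall ij : 'I_n * 'I_n,
    `|mexp A ij.1 ij.2 - mexp_sum A m ij.1 ij.2| <= e.
  apply: filter_forall => ij.
  exact: (iffLR (cvgrPdist_le _ _) (cij ij.1 ij.2) _ e0).
apply: filterS => m H; apply: mx_norm_le => [|i j]; first exact: ltW.
by rewrite !mxE; have := H (i, j); rewrite mxE.
Qed.

Lemma cvg_mexp_linear n (W : normedModType R) (L : {linear 'M[R]_n -> W}) (A : 'M[R]_n) :
  L (mexp_sum A m) @[m --> \oo] --> L (mexp A).
Proof.
by apply: continuous_cvg; [exact: linear_continuous_mx|exact: cvg_mexp_sum].
Qed.

Fact ursubmx_linear m1 m2 n1 n2 : linear (@ursubmx R m1 m2 n1 n2).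
Proof. by move=> a A B; apply/matrixP => i j; rewrite !mxE. Qed.

HB.instance Definition _ m1 m2 n1 n2 :=
  GRing.isLinear.Build R _ _ _ (@ursubmx R m1 m2 n1 n2) (@ursubmx_linear m1 m2 n1 n2).

(** This is the sum over [i], [j] of [A^i E B^j / (i + j + 1)!], the noncommutative divided
    difference of the exponential. For [A = B] it is the Fréchet derivative at [A] in direction
    [E]. *)
Definition divdiff_exp n (A B E : 'M[R]_n) : 'M[R]_n :=
  ursubmx (mexp (block_mx A E 0 B)).

Lemma exprmxS n (A : 'M[R]_n) k : A ^+ k.+1 = A *m A ^+ k.
Proof. exact: exprS. Qed.

Lemma block_mx1 n : 1 = block_mx 1 0 0 1 :> 'M[R]_(n + n).
Proof. exact: scalar_mx_block. Qed.

Lemma block_pow n (A E B : 'M[R]_n) k :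
  block_mx A E 0 B ^+ k = block_mx (A ^+ k) (ursubmx (block_mx A E 0 B ^+ k)) 0 (B ^+ k).
Proof.
suff [C ->] : exists C, block_mx A E 0 B ^+ k = block_mx (A ^+ k) C 0 (B ^+ k).
  by rewrite block_mxKur.
elim: k => [|k [C IH]]; first by exists 0; rewrite !expr0 block_mx1.
exists (A *m C + E *m B ^+ k).
by rewrite !exprmxS IH mulmx_block !mul0mx !mulmx0 !add0r !addr0.
Qed.

Lemma ursubmx_block_powS n (A E B : 'M[R]_n) k :
  ursubmx (block_mx A E 0 B ^+ k.+1) = A *m ursubmx (block_mx A E 0 B ^+ k) + E *m B ^+ k.
Proof. by rewrite exprmxS {1}block_pow mulmx_block block_mxKur. Qed.

(* [[A, E; 0, B]] is conjugate to [diag(A, B)] when [t E = A - B]; hence divided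
   differences of matrix functions are blocks of the same function in twice the
   dimension. *)
Lemma ursubmx_block_pow_sub n (A E B : 'M[R]_n) t k : t *: E = A - B ->
  t *: ursubmx (block_mx A E 0 B ^+ k) = A ^+ k - B ^+ k.
Proof.
move=> tE; elim: k => [|k IH].
  rewrite !expr0 subrr block_mx1 block_mxKur scaler0 //.
rewrite ursubmx_block_powS scalerDr scalemxAr IH scalemxAl tE.
by rewrite mulmxBr mulmxBl addrA subrK !exprmxS.
Qed.

Lemma mexp_sub n (A E B : 'M[R]_n) t : t *: E = A - B ->
  mexp A - mexp B = t *: divdiff_exp A B E.
Proof.
move=> tE.
have c1 : mexp_sum A m - mexp_sum B m @[m --> \oo] --> mexp A - mexp B.
  by apply: cvgB; exact: cvg_mexp_sum.
have c2 : t *: ursubmx (mexp_sum (block_mx A E 0 B) m) @[m --> \oo] --> t *: divdiff_exp A B E.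
  apply: (@cvgZl_tmp _ _ _ _ _ t (fun m => ursubmx (mexp_sum (block_mx A E 0 B) m))).
  exact: cvg_mexp_linear.
apply: (cvg_unique (@norm_hausdorff _ _) c1); apply: cvg_trans c2.
apply: near_eq_cvg; near=> m.
rewrite /mexp_sum linear_sum scaler_sumr -sumrB; apply: eq_bigr => k _.
by rewrite linearZ /= -scalerBr -(ursubmx_block_pow_sub k tE) !scalerA mulrC.
Unshelve. all: by end_near. Qed.

Fact divdiff_exp_linear n (A B : 'M[R]_n) : linear (divdiff_exp A B).
Proof.
move=> a E E'.
have c E0 : ursubmx (mexp_sum (block_mx A E0 0 B) m) @[m --> \oo] --> divdiff_exp A B E0.
  exact: cvg_mexp_linear.
have c2 : a *: ursubmx (mexp_sum (block_mx A E 0 B) m) +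
    ursubmx (mexp_sum (block_mx A E' 0 B) m) @[m --> \oo] -->
    a *: divdiff_exp A B E + divdiff_exp A B E'.
  by apply: cvgD (c E'); exact: (@cvgZl_tmp _ _ _ _ _ a _ _ (c E)).
apply: (cvg_unique (@norm_hausdorff _ _) (c _)); apply: cvg_trans c2.
apply: near_eq_cvg; near=> m.
rewrite /mexp_sum !linear_sum -big_split/=; apply: eq_bigr => k _.
rewrite !linearZ/= -scalerDr; congr (_ *: _).
elim: (val k) => [|j IH].
  by rewrite !expr0 block_mx1 block_mxKur scaler0 addr0.
rewrite !ursubmx_block_powS -IH mulmxDr mulmxDl -scalemxAr -scalemxAl scalerDr.
by rewrite addrACA.
Unshelve. all: by end_near. Qed.

HB.instance Definition _ n (A B : 'M[R]_n) :=
  GRing.isLinear.Build R 'M[R]_n 'M[R]_n _ (divdiff_exp A B) (@divdiff_exp_linear n A B).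

Lemma mexp_norm n (A : 'M[R]_n) : `|mexp A| <= expR (n%:R * `|A|).
Proof.
apply: (@cvgr_to_le _ \oo _ _ (fun m => `|mexp_sum A m|) `|mexp A|).
  by apply: cvg_norm; exact: cvg_mexp_sum.
by near=> m; exact: mexp_sum_norm.
Unshelve. all: by end_near. Qed.

Lemma mx_norm_block n (A B C D : 'M[R]_n) :
  `|block_mx A B C D| <= `|A| + `|B| + `|C| + `|D|.
Proof.
apply: mx_norm_le => [|k l]; first by rewrite !addr_ge0.
move: (normr_ge0 A) (normr_ge0 B) (normr_ge0 C) (normr_ge0 D).
rewrite -[k]fintype.splitK -[l]fintype.splitK.
case: (fintype.split k) => i; case: (fintype.split l) => j /=.
- rewrite block_mxEul; move: (mx_norm_entry A i j); lra.
- rewrite block_mxEur; move: (mx_norm_entry B i j); lra.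
- rewrite block_mxEdl; move: (mx_norm_entry C i j); lra.
- rewrite block_mxEdr; move: (mx_norm_entry D i j); lra.
Qed.

Lemma mx_norm_ursubmx n (A : 'M[R]_(n + n)) : `|ursubmx A| <= `|A|.
Proof. by apply: mx_norm_le => // i j; rewrite !mxE; exact: mx_norm_entry. Qed.

Lemma divdiff_exp_norm n (A B E : 'M[R]_n) r : `|A| <= r -> `|B| <= r -> `|E| <= 1 ->
  `|divdiff_exp A B E| <= expR ((n + n)%:R * (r + r + 1)).
Proof.
move=> Ar Br E1.
apply: le_trans (mx_norm_ursubmx _) _.
apply: le_trans (mexp_norm _) _; rewrite ler_expR ler_wpM2l//.
apply: le_trans (mx_norm_block _ _ _ _) _; rewrite normr0 addr0 addrAC.
by rewrite lerD// lerD.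
Qed.

(** Splitting off the length of an increment keeps the off-diagonal block bounded while the
    increment tends to zero, and covers the zero increment as well. *)
Lemma scale_norm_dir (V : normedModType R) (E : V) : exists E', `|E'| <= 1 /\ `|E| *: E' = E.
Proof.
have [->|E0] := eqVneq E 0; first by exists 0; rewrite normr0 scaler0.
exists (`|E|^-1 *: E); rewrite scalerA mulfV ?normr_eq0// scale1r; split=> //.
by rewrite normrZ normfV normr_id mulVf// normr_eq0.
Qed.

Lemma mexp_lipschitz n (A B : 'M[R]_n) r : `|A| <= r -> `|B| <= r ->
  `|mexp A - mexp B| <= expR ((n + n)%:R * (r + r + 1)) * `|A - B|.
Proof.
move=> Ar Br; have [E [E1 tE]] := scale_norm_dir (A - B).
rewrite (mexp_sub tE) normrZ normr_id mulrC ler_wpM2r//.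
exact: divdiff_exp_norm.
Qed.

(** With [E = |E| E'], the remainder is [|E|] times the difference of the divided differences at
    [(E + S, S)] and [(S, S)] in direction [E']. That difference is a block of a difference of two
    exponentials in twice the dimension, so the Lipschitz bound makes the remainder quadratic in
    [E]. *)
Lemma mexp_differential n (S : 'M[R]_n) :
  differentiable (@mexp n) S /\ 'd (@mexp n) S = divdiff_exp S S :> (_ -> _).
Proof.
(* A bound for the norms of both block matrices below when [|E| <= 1] and [|E'| <= 1]. The dimension
   in the constant is doubled twice: once for the block matrices, once for the Lipschitz bound on
   their exponentials. *)
set r := `|S| + `|S| + 3.
apply: (differentiable_quadratic (C := expR ((n + n + (n + n))%:R * (r + r + 1)))).
  exact: linear_continuous_mx.
near=> E.
have E1 : `|E| <= 1 by near: E; apply: (nbhs0_le (V := 'M[R]_n)); exact: ltr01.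
have [E' [E1' tE]] := scale_norm_dir E.
have tE2 : `|E| *: E' = E + S - S by rewrite addrK.
rewrite opprD addrA (mexp_sub tE2)/=.
have -> : divdiff_exp S S E = `|E| *: divdiff_exp S S E' by rewrite -linearZ/= tE.
rewrite -scalerBr normrZ normr_id expr2 mulrCA.
rewrite ler_wpM2l//.
apply: (@le_trans _ _ `|mexp (block_mx (E + S) E' 0 S) - mexp (block_mx S E' 0 S)|).
  by rewrite /divdiff_exp -linearB; exact: mx_norm_ursubmx.
apply: le_trans (mexp_lipschitz (r := r) _ _) _.
- apply: le_trans (mx_norm_block _ _ _ _) _; rewrite normr0 addr0 /r.
  have := ler_normD E S; lra.
- apply: le_trans (mx_norm_block _ _ _ _) _; rewrite normr0 addr0 /r.
  lra.
rewrite ler_wpM2l ?expR_ge0//.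
rewrite opp_block_mx add_block_mx addrK !subrr.
by apply: le_trans (mx_norm_block _ _ _ _) _; rewrite !normr0 !addr0.
Unshelve. all: by end_near. Qed.

(** The induction on [k] quantifies over all sizes: a directional derivative in size [n] is a block
    of the exponential in size [n + n], evaluated at an affine function of the argument. *)
Lemma mexp_smooth n : smooth setT (@mexp n).
Proof.
move=> k; elim: k n => [|k IH] n.
  move=> q _; apply: differentiable_continuous; exact: (mexp_differential q).1.
split=> [q _|E]; first exact: (mexp_differential q).1.
pose L (S : 'M[R]_n) : 'M[R]_(n + n) := block_mx S 0 0 S.
have linL : linear L.
  by move=> a x y; rewrite /L scale_block_mx add_block_mx !scaler0 !addr0.
pose LM := GRing.isLinear.Build R _ _ _ L linL.
pose LL : {linear 'M[R]_n -> 'M[R]_(n + n)} := HB.pack L LM.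
apply: (Ck_eq openT (f := fun q => ursubmx (mexp (block_mx 0 E 0 0 + LL q)))).
  move=> q _; have [dq dE] := mexp_differential q.
  rewrite deriveE// dE /divdiff_exp; congr (ursubmx (mexp _)).
  by rewrite /= /L add_block_mx !add0r !addr0.
apply: (Ck_linear openT); first exact: linear_continuous_mx.
apply: (@Ck_affine _ _ _ openT _ _ k setT (@mexp (n + n)) _ LL) => //.
exact: linear_continuous_mx.
Qed.

End MatrixExponential.

(** * Spectral calculus on symmetric matrices *)

Section SpectralTheorem.
Context {R : realType}.

Lemma row_dotC n (x y : 'rV[R]_n) : x *m y^T = y *m x^T.
Proof.
apply: trmx_inj; rewrite trmx_mul trmxK [RHS]mx11_scalar [LHS]mx11_scalar.
by congr (_%:M); rewrite !mxE; apply: eq_bigr => i _; rewrite !mxE mulrC.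
Qed.

Lemma row_dot_ge0 n (x : 'rV[R]_n) : 0 <= (x *m x^T) 0 0.
Proof. by rewrite mxE sumr_ge0// => i _; rewrite mxE -expr2 sqr_ge0. Qed.

Lemma row_dot_eq0 n (x : 'rV[R]_n) : (x *m x^T) 0 0 = 0 -> x = 0.
Proof.
rewrite mxE => /eqP; rewrite psumr_eq0 => [/allP H|i _]; last first.
  by rewrite mxE -expr2 sqr_ge0.
apply/rowP => i; have := H i; rewrite mem_index_enum => /(_ isT).
by rewrite !mxE -expr2 sqrf_eq0 => /eqP.
Qed.

(* Take a complex eigenvector [x + i y] and pair [x] with [y]. *)
Lemma symmetric_eigenvalue n (A : 'M[R]_n.+1) : A^T = A ->
  exists a (x : 'rV[R]_n.+1), x != 0 /\ x *m A = a *: x.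
Proof.
move=> symA.
have [a /eigenvalueP[v vA v0]] :=
  eigenvalue_closed (map_mx (complex.real_complex R) A) (ltn0Sn n).
pose x := map_mx (@complex.Re R) v; pose y := map_mx (@complex.Im R) v.
pose p := complex.Re a; pose q := complex.Im a.
have xA : x *m A = p *: x - q *: y.
  apply/rowP => j; move/rowP: vA => /(_ j).
  rewrite !mxE => /(congr1 (@complex.Re R)); rewrite raddf_sum => vA.
  transitivity (complex.Re (a * v 0 j)).
    rewrite -vA; apply: eq_bigr => k _; rewrite !mxE.
    by case: (v 0 k) => b c /=; rewrite mulr0 subr0.
  by rewrite /p /q; case: (a) => a1 b1; case: (v 0 j) => c d.
have yA : y *m A = q *: x + p *: y.
  apply/rowP => j; move/rowP: vA => /(_ j).
  rewrite !mxE => /(congr1 (@complex.Im R)); rewrite raddf_sum => vA.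
  transitivity (complex.Im (a * v 0 j)).
    rewrite -vA; apply: eq_bigr => k _; rewrite !mxE.
    by case: (v 0 k) => b c /=; rewrite mulr0 add0r.
  by rewrite /p /q; case: (a) => a1 b1; case: (v 0 j) => c d /=; rewrite addrC.
have v0' : x != 0 \/ y != 0.
  have [x0|x0] := eqVneq x 0; last by left.
  right; apply: contra v0 => /eqP y0; apply/eqP/rowP => j; rewrite mxE.
  move/rowP: x0 => /(_ j); move/rowP: y0 => /(_ j); rewrite !mxE.
  by case: (v 0 j) => c d /= -> ->.
have q0 : q = 0.
  have E : x *m A *m y^T = x *m (y *m A)^T by rewrite trmx_mul symA mulmxA.
  move: E; rewrite xA yA [(_ + _)^T]linearD/= ![(_ *: _)^T]linearZ/= mulmxBl mulmxDr.
  rewrite -!scalemxAl -!scalemxAr.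
  move=> /(congr1 (fun M : 'M[R]_1 => M 0 0)); rewrite !mxE => E.
  have {}E : q * ((x *m x^T) 0 0 + (y *m y^T) 0 0) = 0 by rewrite !mxE; lra.
  move/eqP: E; rewrite mulf_eq0 => /orP[/eqP//|/eqP E].
  have [xx yy] := (row_dot_ge0 x, row_dot_ge0 y).
  have x0 : x = 0 by apply: row_dot_eq0; lra.
  have y0 : y = 0 by apply: row_dot_eq0; lra.
  by move: v0'; rewrite x0 y0 eqxx => -[].
move: xA yA; rewrite q0 !scale0r subr0 add0r => xA yA.
by case: v0' => ?; exists p; [exists x|exists y].
Qed.

(** For [u] different from the first basis vector [e], [W] is the reflection in the hyperplane
    orthogonal to [w = u - e]. It exchanges [e] and [u] because both are unit vectors, which gives
    [2 e.w = - w.w]. *)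
Lemma householder n (u : 'rV[R]_n.+1) : u *m u^T = 1%:M ->
  exists W : 'M[R]_n.+1, [/\ W^T = W, W *m W = 1%:M & delta_mx 0 0 *m W = u].
Proof.
move=> uu; pose e : 'rV[R]_n.+1 := delta_mx 0 0; rewrite -/e.
have ee : e *m e^T = 1%:M.
  by rewrite trmx_delta mul_delta_mx; apply/matrixP => i j; rewrite !mxE !ord1.
pose w := u - e; have [w0|w0] := eqVneq w 0.
  exists 1%:M; rewrite trmx1 !mulmx1; split=> //.
  by apply/eqP; rewrite eq_sym -subr_eq0; apply/eqP.
pose t := (w *m w^T) 0 0.
have t0 : t != 0 by apply: contra w0 => /eqP/row_dot_eq0 ->.
have wwt : w *m w^T = t%:M by rewrite -mx11_scalar.
pose c := (e *m u^T) 0 0; have eu : e *m u^T = c%:M by rewrite -mx11_scalar.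
have ew : 2 *: (e *m w^T) = - (w *m w^T).
  rewrite /w linearB/= mulmxBl !mulmxBr uu ee (row_dotC u e) eu.
  by rewrite -!raddfB/= scale_scalar_mx -raddfN/=; congr (_%:M); ring.
exists (1%:M - (2 / t) *: (w^T *m w)); split.
- by rewrite linearB/= trmx1 linearZ/= trmx_mul trmxK.
- rewrite mulmxBr mulmx1 mulmxBl mul1mx -scalemxAl -scalemxAr mulmxA -(mulmxA _ w).
  rewrite wwt mul_mx_scalar -scalemxAl !scalerA opprB.
  have -> : 2 / t * (2 / t * t) = 2 / t + 2 / t by field.
  by rewrite scalerDl addrK subrK.
rewrite mulmxBr mulmx1 -scalemxAr mulmxA mulrC -scalerA scalemxAl ew.
rewrite wwt mulNmx mul_scalar_mx scalerN scalerA mulVf// scale1r opprK.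
by rewrite /w addrC subrK.
Qed.

(** Deflation: a reflection moves a unit eigenvector to the first basis vector, after which symmetry
    clears the first row and column outside the corner, and the remaining block is diagonalised by
    induction. *)
Lemma spectral_theorem n (A : 'M[R]_n) : A^T = A -> exists (U : 'M[R]_n) (d : 'rV[R]_n),
  U *m U^T = 1%:M /\ A = U^T *m diag_mx d *m U.
Proof.
elim: n A => [|n IH] A symA.
  by exists 1%:M, 0; split; apply/matrixP => -[].
have [a [x [x0 xA]]] := symmetric_eigenvalue symA.
pose r := Num.sqrt ((x *m x^T) 0 0).
have r0 : r != 0.
  rewrite sqrtr_eq0 -ltNge lt_neqAle row_dot_ge0 andbT eq_sym.
  by apply: contra x0 => /eqP /row_dot_eq0 ->.
pose u := r^-1 *: x.
have uu : u *m u^T = 1%:M.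
  rewrite /u linearZ/= -scalemxAl -scalemxAr scalerA [x *m _]mx11_scalar scale_scalar_mx.
  congr (_%:M); rewrite -invfM -expr2 sqr_sqrtr ?row_dot_ge0// mulVf//.
  by rewrite -[X in X != 0](@sqr_sqrtr _ _ (row_dot_ge0 x)) expf_neq0.
have uA : u *m A = a *: u by rewrite -scalemxAl xA /u !scalerA mulrC.
have [W [Wt WW eW]] := householder uu.
pose B : 'M[R]_(1 + n) := W *m A *m W.
have eB : delta_mx 0 0 *m B = a *: delta_mx 0 0 :> 'rV[R]_(1 + n).
  rewrite /B !mulmxA eW uA -scalemxAl; congr (_ *: _).
  by rewrite -eW -mulmxA WW mulmx1.
have symB : B^T = B by rewrite !trmx_mul Wt symA mulmxA.
have AB : A = W *m B *m W by rewrite /B !mulmxA WW mul1mx -mulmxA WW mulmx1.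
clearbody B.
have B0 j : B 0 j = a * (j == 0)%:R.
  move/rowP: eB => /(_ j); rewrite -rowE !mxE => ->.
  by rewrite eqxx.
have ur0 : ursubmx B = 0.
  by apply/rowP => j; rewrite !mxE lshift0 B0 mulr0.
have dl0 : dlsubmx B = 0 by rewrite -[B]symB -trmx_ursub ur0 trmx0.
have ul : ulsubmx B = a%:M.
  by apply/matrixP => i j; rewrite !mxE !ord1 lshift0 B0 mulr1.
have [V [d [VV BE]]] : exists (U : 'M[R]_n) (d : 'rV[R]_n),
    U *m U^T = 1%:M /\ drsubmx B = U^T *m diag_mx d *m U.
  by apply: IH; rewrite trmx_drsub symB.
pose U0 : 'M[R]_(1 + n) := block_mx 1%:M 0 0 V.
have U0U0 : U0 *m U0^T = 1%:M.
  rewrite tr_block_mx !trmx0 trmx1 mulmx_block !mul0mx !mulmx0 !mul1mx VV !addr0 !add0r.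
  by rewrite -scalar_mx_block.
have BE' : B = U0^T *m diag_mx (row_mx a%:M d) *m U0.
  rewrite -[LHS]submxK ur0 dl0 ul BE diag_mx_row tr_block_mx !trmx0 trmx1.
  rewrite !mulmx_block !mul0mx !mulmx0 !mul1mx !mulmx1 !addr0 !add0r.
  congr block_mx; rewrite ?mul0mx //; apply/matrixP => i j; by rewrite !ord1 !mxE.
exists (U0 *m W), (row_mx a%:M d); split.
  by rewrite trmx_mul Wt mulmxA -(mulmxA U0) WW mulmx1 U0U0.
by rewrite AB {1}BE' trmx_mul Wt !mulmxA.
Qed.

End SpectralTheorem.

Section SpectralCalculus.
Context {R : realType} {n : nat}.
Implicit Types (A B P Q : sym R n) (U V : 'M[R]_n) (d e : 'rV[R]_n).

Lemma val_symT A : (val A)^T = val A.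
Proof. exact/symspaceP/valP. Qed.

Lemma sym_diagonalization A : exists U d,
  U *m U^T = 1%:M /\ val A = U^T *m diag_mx d *m U.
Proof. exact: spectral_theorem (val_symT A). Qed.

Lemma diag_mulE d (W : 'M[R]_n) i j : (diag_mx d *m W) i j = d 0 i * W i j.
Proof. by rewrite mul_diag_mx mxE. Qed.

Lemma mul_diagE m d (W : 'M[R]_(m, n)) i j : (W *m diag_mx d) i j = W i j * d 0 j.
Proof. by rewrite mul_mx_diag mxE. Qed.

(** This is the independence of [spectral_fun] from the diagonalisation. The transition matrix [W]
    satisfies [d_i W_ij = W_ij e_j], so wherever [W_ij] is nonzero the eigenvalues agree, and so do
    their images under [f]. *)
Lemma diag_conj_eq (f : R -> R) U V d e :
  U *m U^T = 1%:M -> V *m V^T = 1%:M ->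
  U^T *m diag_mx d *m U = V^T *m diag_mx e *m V ->
  U^T *m diag_mx (map_mx f d) *m U = V^T *m diag_mx (map_mx f e) *m V.
Proof.
move=> UU VV E; have UU' := mulmx1C UU; have VV' := mulmx1C VV.
pose W := U *m V^T.
have dW : diag_mx d *m W = W *m diag_mx e.
  have := congr1 (fun M => U *m M *m V^T) E.
  by rewrite !mulmxA UU mul1mx -!mulmxA VV mulmx1 !mulmxA.
have fW : diag_mx (map_mx f d) *m W = W *m diag_mx (map_mx f e).
  apply/matrixP => i j; move/matrixP: dW => /(_ i j).
  rewrite !diag_mulE !mul_diagE.
  have [->|W0] := eqVneq (W i j) 0; first by rewrite !mulr0 !mul0r.
  by rewrite mulrC => /(mulfI W0) de; rewrite mulrC [map_mx f d 0 i]mxE [map_mx f e 0 j]mxE de.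
have := congr1 (fun M => U^T *m M *m V) fW.
by rewrite /W !mulmxA -(mulmxA _ V^T) VV' mulmx1 UU' mul1mx.
Qed.

Lemma spectral_funE (f : R -> R) A U d :
  U *m U^T = 1%:M -> val A = U^T *m diag_mx d *m U ->
  val (spectral_fun f A) = U^T *m diag_mx (map_mx f d) *m U.
Proof.
move=> UU AE; rewrite /spectral_fun; case: xgetP => [B _ [V [e [VV AE' ->]]]|].
  by apply: diag_conj_eq => //; rewrite -AE -AE'.
have Bsym : U^T *m diag_mx (map_mx f d) *m U \in symspace R n.
  by apply/symspaceP; rewrite !trmx_mul trmxK tr_diag_mx mulmxA.
by move=> /(_ (Subvs Bsym)) []; exists U, d.
Qed.

Lemma trace_sqr (X : 'M[R]_n) : \tr (X *m X^T) = \sum_i \sum_j X i j ^+ 2.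
Proof. by apply: eq_bigr => i _; rewrite mxE; apply: eq_bigr => j _; rewrite mxE. Qed.

Lemma norm_le_trace_sqr (X : 'M[R]_n) : `|X| ^+ 2 <= \tr (X *m X^T).
Proof.
have t0 : 0 <= \tr (X *m X^T).
  by rewrite trace_sqr; do 2!(apply: sumr_ge0 => ? _); exact: sqr_ge0.
rewrite -[leRHS]sqr_sqrtr// lerXn2r ?nnegrE ?sqrtr_ge0//.
apply: mx_norm_le => [|i j]; first exact: sqrtr_ge0.
rewrite -sqrtr_sqr ler_sqrt// trace_sqr (bigD1 i)//= (bigD1 j)//=.
rewrite -addrA lerDl addr_ge0 ?sumr_ge0// => *; rewrite ?sqr_ge0//.
by rewrite sumr_ge0// => *; rewrite sqr_ge0.
Qed.

Lemma trace_sqr_le_norm (X : 'M[R]_n) : \tr (X *m X^T) <= (n%:R * `|X|) ^+ 2.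
Proof.
rewrite trace_sqr; apply: (@le_trans _ _ (\sum_(i < n) \sum_(j < n) `|X| ^+ 2)).
  apply: ler_sum => i _; apply: ler_sum => j _; rewrite -[leLHS]real_normK ?num_real//.
  by rewrite lerXn2r ?nnegrE// mx_norm_entry.
by rewrite !sumr_const card_ord -mulrnA -[leLHS]mulr_natl natrM exprMn expr2.
Qed.

Lemma trace_sqr_diag_conj U V d e : U *m U^T = 1%:M -> V *m V^T = 1%:M ->
  let X := U^T *m diag_mx d *m U - V^T *m diag_mx e *m V in
  \tr (X *m X^T) = \sum_i \sum_j ((d 0 i - e 0 j) * (U *m V^T) i j) ^+ 2.
Proof.
move=> UU VV X; have UU' := mulmx1C UU; have VV' := mulmx1C VV.
transitivity (\tr ((U *m X *m V^T) *m (U *m X *m V^T)^T)).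
  rewrite !trmx_mul trmxK -!mulmxA (mulmxA V^T) VV' mul1mx [RHS]mxtrace_mulC.
  by rewrite -!mulmxA UU' mulmx1.
have -> : U *m X *m V^T = diag_mx d *m (U *m V^T) - (U *m V^T) *m diag_mx e.
  rewrite /X mulmxBr mulmxBl !mulmxA UU mul1mx; congr (_ - _).
  by rewrite -!mulmxA VV mulmx1.
rewrite trace_sqr; apply: eq_bigr => i _; apply: eq_bigr => j _; congr (_ ^+ 2).
by rewrite [LHS]mxE [X in _ + X]mxE diag_mulE mul_diagE mulrBl [e 0 j * _]mulrC.
Qed.

Lemma quadratic_form_diag U d (x : 'rV[R]_n) :
  (x *m (U^T *m diag_mx d *m U) *m x^T) 0 0 = \sum_i d 0 i * ((x *m U^T) 0 i) ^+ 2.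
Proof.
have -> : x *m (U^T *m diag_mx d *m U) *m x^T = (x *m U^T *m diag_mx d) *m (x *m U^T)^T.
  by rewrite trmx_mul trmxK !mulmxA.
rewrite mxE; apply: eq_bigr => i _.
by rewrite mul_diagE [X in _ * X]mxE mulrAC mulrC expr2.
Qed.

Lemma row_norm_diag U (x : 'rV[R]_n) : U *m U^T = 1%:M ->
  \sum_i ((x *m U^T) 0 i) ^+ 2 = (x *m x^T) 0 0.
Proof.
move=> UU; transitivity (((x *m U^T) *m (x *m U^T)^T) 0 0).
  by rewrite mxE; apply: eq_bigr => i _; rewrite [X in _ = _ * X]mxE expr2.
by rewrite trmx_mul trmxK mulmxA -(mulmxA x) (mulmx1C UU) mulmx1.
Qed.

Lemma row_ortho U d i : U *m U^T = 1%:M ->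
  (row i U *m (U^T *m diag_mx d *m U) *m (row i U)^T) 0 0 = d 0 i /\
  (row i U *m (row i U)^T) 0 0 = 1.
Proof.
move=> UU; have rU : row i U *m U^T = delta_mx 0 i by rewrite -row_mul UU row1.
split; last first.
  rewrite -(row_norm_diag _ UU) rU (bigD1 i)//= big1 ?addr0 ?mxE ?eqxx ?expr1n//.
  by move=> j /negbTE ji; rewrite mxE ji expr0n.
rewrite quadratic_form_diag rU (bigD1 i)//= big1 ?addr0 ?mxE ?eqxx ?expr1n ?mulr1// => j /negbTE ji.
by rewrite mxE ji expr0n mulr0.
Qed.

Lemma sympd_diag P U d : U *m U^T = 1%:M -> val P = U^T *m diag_mx d *m U ->
  sympd P <-> forall i, 0 < d 0 i.
Proof.
move=> UU PE; split=> [pP i|d0 x x0].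
  have [<- r1] := row_ortho d i UU; rewrite -PE; apply: pP.
  by apply: contraTneq isT => r0; move: r1; rewrite r0 mul0mx mxE => /esym/eqP; rewrite oner_eq0.
rewrite PE quadratic_form_diag.
have s0 i : 0 <= d 0 i * ((x *m U^T) 0 i) ^+ 2 by rewrite mulr_ge0 ?sqr_ge0 ?ltW.
rewrite lt_neqAle sumr_ge0 ?andbT; last by move=> i _; exact: s0.
rewrite eq_sym psumr_eq0; last by move=> i _; exact: s0.
apply: contra x0 => /allP H.
apply/eqP/row_dot_eq0; rewrite -(row_norm_diag _ UU); apply: big1 => i _.
have := H i; rewrite mem_index_enum => /(_ isT); rewrite mulf_eq0 gt_eqF//=.
by move=> /eqP.
Qed.

Lemma quadratic_form_le (X : 'M[R]_n) (x : 'rV[R]_n) :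
  `|(x *m X *m x^T) 0 0| <= n%:R ^+ 2 * `|X| * (x *m x^T) 0 0.
Proof.
have xle i : `|x 0 i| ^+ 2 <= (x *m x^T) 0 0.
  rewrite mxE (bigD1 i)//= mxE real_normK ?num_real// -expr2 lerDl sumr_ge0// => j _.
  by rewrite mxE -expr2 sqr_ge0.
have x0 := row_dot_ge0 x.
have xx i j : `|x 0 i * x 0 j| <= (x *m x^T) 0 0.
  have := xle i; have := xle j; rewrite normrM.
  have := sqr_ge0 (`|x 0 i| - `|x 0 j|); rewrite sqrrB; lra.
rewrite mxE (le_trans (ler_norm_sum _ _ _))//.
apply: (@le_trans _ _ (\sum_(j < n) \sum_(i < n) `|X| * (x *m x^T) 0 0)).
  apply: ler_sum => j _; rewrite mxE mulr_suml (le_trans (ler_norm_sum _ _ _))//.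
  apply: ler_sum => i _; rewrite [x^T _ _]mxE mulrAC mulrC normrM.
  by rewrite ler_pM// mx_norm_entry.
by rewrite !sumr_const card_ord -mulrnA -[leLHS]mulr_natl natrM expr2 !mulrA.
Qed.

(** A uniform positive lower bound for the spectrum near [P]; it yields both the openness of [sympd]
    and the Lipschitz bound for the logarithm. The quadratic form of [P] is at least [2 m] on unit
    vectors, and the radius is such that the perturbation costs at most [m]. *)
Lemma sympd_eigenvalue_lower P : sympd P -> exists2 m, 0 < m &
  forall Q U d i, `|Q - P| <= m / (n%:R ^+ 2 + 1) ->
    U *m U^T = 1%:M -> val Q = U^T *m diag_mx d *m U -> m <= d 0 i.
Proof.
move=> pP; have [V [e [VV PE]]] := sym_diagonalization P.
have e0 := (sympd_diag VV PE).1 pP.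
have [m m0 me] : exists2 m, 0 < m & forall i, 2 * m <= e 0 i.
  (* Half the least eigenvalue, capped at [1], which also gives a positive value when there are no
     eigenvalues. *)
  exists (\big[Num.min/1]_i (e 0 i / 2)).
    by apply/bigmin_gtP; split=> // i _; rewrite divr_gt0.
  move=> i; rewrite mulrC -ler_pdivlMr//; exact: bigmin_le.
exists m => // Q U d i QP UU QE.
have [<- r1] := row_ortho d i UU; rewrite -QE.
have -> : val Q = val P + val (Q - P) by rewrite linearB/= addrC subrK.
rewrite mulmxDr mulmxDl mxE.
have H1 : 2 * m <= (row i U *m val P *m (row i U)^T) 0 0.
  rewrite PE quadratic_form_diag -[leLHS]mulr1 -[X in _ * X]r1 -(row_norm_diag _ VV) mulr_sumr.
  by apply: ler_sum => j _; rewrite ler_wpM2r ?sqr_ge0.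
have := quadratic_form_le (val (Q - P)) (row i U); rewrite r1 mulr1.
have : n%:R ^+ 2 * `|val (Q - P)| <= m.
  apply: (@le_trans _ _ (n%:R ^+ 2 * (m / (n%:R ^+ 2 + 1)))).
    by rewrite ler_wpM2l ?sqr_ge0.
  by rewrite mulrA ler_pdivrMr ?ltr_wpDl ?sqr_ge0// mulrC ler_pM2l// lerDl.
move=> /(le_trans _) H /H; rewrite ler_norml => /andP[H2 _]; lra.
Qed.

Lemma open_sympd : open (@sympd R n).
Proof.
rewrite openE => P pP; have [m m0 H] := sympd_eigenvalue_lower pP.
have k0 : 0 < m / (n%:R ^+ 2 + 1) by rewrite divr_gt0// ltr_wpDl ?sqr_ge0.
apply/nbhs_ballP; exists (m / (n%:R ^+ 2 + 1)) => //= Q.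
rewrite -ball_normE/= distrC => /ltW QP.
have [U [d [UU QE]]] := sym_diagonalization Q.
by apply/(sympd_diag UU QE) => i; apply: lt_le_trans m0 _; exact: H QP UU QE.
Qed.

Lemma ln_lipschitz (m a b : R) : 0 < m -> m <= a -> m <= b ->
  `|ln a - ln b| <= m^-1 * `|a - b|.
Proof.
move=> m0; wlog ab : a b / b <= a.
  move=> H ma mb; have [/H|/ltW/H] := leP b a; first exact.
  by rewrite distrC [`|a - b|]distrC; apply.
move=> ma mb; have b0 := lt_le_trans m0 mb; have a0 := lt_le_trans m0 ma.
rewrite !ger0_norm ?subr_ge0 ?ler_ln ?posrE//.
rewrite -ln_div ?posrE//.
have -> : a / b = 1 + (a / b - 1) by rewrite addrC subrK.
have ab0 : 0 < a / b by rewrite divr_gt0.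
apply: le_trans (le_ln1Dx _) _; first by rewrite ltrBDl subrr.
have -> : a / b - 1 = b^-1 * (a - b) by field; rewrite gt_eqF.
by rewrite ler_wpM2r ?subr_ge0// lef_pV2 ?posrE.
Qed.

End SpectralCalculus.

(** * Exponential, logarithm and powers of symmetric matrices *)

Section ExpLog.
Context {R : realType} {n : nat}.
Implicit Types (A B P Q : sym R n) (U V : 'M[R]_n) (d e : 'rV[R]_n).

Lemma sym_eq A B U d : U *m U^T = 1%:M ->
  val A = U^T *m diag_mx d *m U -> val B = U^T *m diag_mx d *m U -> A = B.
Proof. by move=> _ AE BE; apply: val_inj; rewrite /= AE BE. Qed.

Lemma diag_conj_mul U d e : U *m U^T = 1%:M ->
  (U^T *m diag_mx d *m U) *m (U^T *m diag_mx e *m U) =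
  U^T *m diag_mx (\row_i (d 0 i * e 0 i)) *m U.
Proof.
move=> UU; rewrite !mulmxA -(mulmxA _ U U^T) UU mulmx1 -(mulmxA U^T (diag_mx d)).
congr (_ *m _ *m _); apply/matrixP => i j.
by rewrite diag_mulE !mxE; case: eqP => [->|_]; rewrite ?mulr1n// ?mulr0n ?mulr0.
Qed.

Lemma mexp_diag U d : U *m U^T = 1%:M ->
  mexp (U^T *m diag_mx d *m U) = U^T *m diag_mx (map_mx expR d) *m U.
Proof.
move=> UU.
have powE k : (U^T *m diag_mx d *m U) ^+ k = U^T *m diag_mx (map_mx (fun x => x ^+ k) d) *m U.
  elim: k => [|k IH].
    rewrite expr0; have -> : map_mx (fun x : R => x ^+ 0) d = const_mx 1.
      by apply/rowP => i; rewrite !mxE expr0.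
    by rewrite diag_const_mx mulmx1 (mulmx1C UU).
  rewrite exprmxS IH diag_conj_mul//.
  by congr (_ *m diag_mx _ *m _); apply/rowP => i; rewrite !mxE exprS.
have entry (r : 'rV[R]_n) i j : (U^T *m diag_mx r *m U) i j = \sum_k U k i * r 0 k * U k j.
  by rewrite mxE; apply: eq_bigr => k _; rewrite mul_diagE [X in X * _ * _]mxE.
apply/matrixP => i j; rewrite entry [LHS]mxE; apply: cvg_lim => //.
have -> : (fun m => mexp_sum (U^T *m diag_mx d *m U) m i j) =
    (fun m => \sum_k U k i * series (exp_coeff (d 0 k)) m * U k j).
  apply/funext => m; rewrite /mexp_sum summxE.
  transitivity (\sum_(l < m) \sum_k U k i * ((d 0 k) ^+ l / l`!%:R) * U k j).
    apply: eq_bigr => l _; rewrite mxE powE entry mulr_sumr; apply: eq_bigr => k _.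
    by rewrite mxE; ring.
  rewrite exchange_big; apply: eq_bigr => k _.
  by rewrite seriesEord/= mulr_sumr mulr_suml.
apply: cvg_big => [|k _]; first exact: add_continuous.
apply: cvgMr_tmp; rewrite mxE; apply: cvgMl_tmp.
exact: is_cvg_series_exp_coeff.
Qed.

Lemma symexp_mexp A : val (symexp A) = mexp (val A).
Proof.
have [U [d [UU AE]]] := sym_diagonalization A.
by rewrite (spectral_funE _ UU AE) AE mexp_diag.
Qed.

Lemma symexpK A : symlog (symexp A) = A.
Proof.
have [U [d [UU AE]]] := sym_diagonalization A.
apply: (sym_eq UU _ AE); rewrite (spectral_funE _ UU (spectral_funE _ UU AE)).
by congr (_ *m diag_mx _ *m _); apply/rowP => i; rewrite !mxE expRK.
Qed.

Lemma symlogK P : sympd P -> symexp (symlog P) = P.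
Proof.
move=> pP; have [U [d [UU PE]]] := sym_diagonalization P.
have d0 := (sympd_diag UU PE).1 pP.
apply: (sym_eq UU _ PE); rewrite (spectral_funE _ UU (spectral_funE _ UU PE)).
by congr (_ *m diag_mx _ *m _); apply/rowP => i; rewrite !mxE lnK ?posrE.
Qed.

Lemma sympd_symexp A : sympd (symexp A).
Proof.
have [U [d [UU AE]]] := sym_diagonalization A.
by apply/(sympd_diag UU (spectral_funE _ UU AE)) => i; rewrite mxE expR_gt0.
Qed.

Lemma sympow_exp P a : sympd P -> sympow P a = symexp (a *: symlog P).
Proof.
move=> pP; have [U [d [UU PE]]] := sym_diagonalization P.
have d0 := (sympd_diag UU PE).1 pP.
have lE : val (a *: symlog P) = U^T *m diag_mx (a *: map_mx (@ln R) d) *m U.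
  by rewrite linearZ/= (spectral_funE _ UU PE) linearZ/= -scalemxAr -scalemxAl.
apply: (sym_eq UU (spectral_funE _ UU PE)); rewrite (spectral_funE _ UU lE).
congr (_ *m diag_mx _ *m _); apply/rowP => i; rewrite !mxE.
by rewrite -ln_powR lnK// posrE powR_gt0.
Qed.

Lemma symexp_mul A (a b : R) :
  val (symexp (a *: A)) *m val (symexp (b *: A)) = val (symexp ((a + b) *: A)).
Proof.
have [U [d [UU AE]]] := sym_diagonalization A.
have E c : val (symexp (c *: A)) = U^T *m diag_mx (map_mx expR (c *: d)) *m U.
  by apply: spectral_funE => //; rewrite !linearZ/= AE -scalemxAl.
apply: (etrans (congr2 mulmx (E a) (E b))); apply: etrans (esym (E (a + b))).
rewrite diag_conj_mul//.
by congr (_ *m diag_mx _ *m _); apply/rowP => i; rewrite !mxE mulrDl expRD.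
Qed.

(* In eigenbases of [Q] and [P] with transition matrix [w], the squared Frobenius
   norm of [f(Q) - f(P)] is the sum of the [((f d_i - f e_j) w_ij)^2]; compare
   [f = ln] with [f = id]. *)
Lemma symlog_lipschitz P : sympd P -> exists2 C, 0 < C &
  \forall Q \near P, `|symlog Q - symlog P| <= C * `|Q - P|.
Proof.
move=> pP; have [m m0 H] := sympd_eigenvalue_lower pP.
exists (m^-1 * n%:R + 1); first by rewrite ltr_wpDl// mulr_ge0// invr_ge0 ltW.
have k0 : 0 < m / (n%:R ^+ 2 + 1) by rewrite divr_gt0// ltr_wpDl ?sqr_ge0.
near=> Q.
have QP : `|Q - P| <= m / (n%:R ^+ 2 + 1).
  by near: Q; apply: (@cvgr_distC_le _ _ _ _ _ id P).
have [U [d [UU QE]]] := sym_diagonalization Q.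
have [V [e [VV PE]]] := sym_diagonalization P.
have md i := H Q U d i QP UU QE.
have PP : `|P - P| <= m / (n%:R ^+ 2 + 1) by rewrite subrr normr0 ltW.
have me i := H P V e i PP VV PE.
apply: (@le_trans _ _ (m^-1 * n%:R * `|Q - P|)); last by rewrite ler_wpM2r// lerDl.
rewrite -ler_sqr ?nnegrE ?mulr_ge0 ?invr_ge0 ?(ltW m0)//.
apply: le_trans (norm_le_trace_sqr (val (symlog Q - symlog P))) _.
rewrite -mulrA exprMn.
have -> : val (symlog Q - symlog P) =
    U^T *m diag_mx (map_mx (@ln R) d) *m U - V^T *m diag_mx (map_mx (@ln R) e) *m V.
  by rewrite linearB/= (spectral_funE _ UU QE) (spectral_funE _ VV PE).
have T := trace_sqr_le_norm (val (Q - P)).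
rewrite trace_sqr_diag_conj//.
apply: le_trans _ (ler_wpM2l (sqr_ge0 _) T).
have -> : val (Q - P) = U^T *m diag_mx d *m U - V^T *m diag_mx e *m V.
  by rewrite linearB/= QE PE.
rewrite trace_sqr_diag_conj// mulr_sumr; apply: ler_sum => i _.
rewrite mulr_sumr; apply: ler_sum => j _.
rewrite -exprMn -[leLHS]real_normK ?num_real// -[leRHS]real_normK ?num_real//.
rewrite ler_sqr ?nnegrE// !normrM mulrA ler_wpM2r// !mxE.
by rewrite [`|m^-1|]ger0_norm ?invr_ge0 ?(ltW m0)//; exact: ln_lipschitz.
Unshelve. all: by end_near. Qed.

End ExpLog.

(** * Smoothness of the logarithm *)

Section InverseFunction.
Context {R : realType} {V W : normedModType R}.
Variables (f : V -> W) (g : W -> V).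

(** The Lipschitz bound on [g] plays the part of the inverse function theorem. Put
    [k = g (h + y) - g y], so that [|k| <= C |h|] and [h = 'd f (g y) k + o(k)]; applying [M] gives
    [k = M h + o(h)]. *)
Lemma inverse_differentiable y C (M : {linear W -> V}) : 0 < C -> continuous M ->
  differentiable f (g y) -> (forall k, M ('d f (g y) k) = k) ->
  (\forall z \near y, `|g z - g y| <= C * `|z - y|) ->
  (\forall z \near y, f (g z) = z) ->
  differentiable g y /\ 'd g y = M :> (_ -> _).
Proof.
move=> C0 cM df Mdf lip fg; apply: differentiable_littleo => // e e0.
have [c c0 Mc] := linear_lipschitz cM.
(* The error of [f] is amplified by the constant [c] of [M] and by the constant [C] of [g]; this
   choice leaves exactly [e]. *)
have eps0 : 0 < e / (c * C) by rewrite divr_gt0 ?mulr_gt0.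
have /nbhs_ballP[r /= r0 Hr] := differentiable_bound df eps0.
have lip0 : \forall h \near 0, `|g (h + y) - g y| <= C * `|h + y - y|.
  by have := near_shift 0 y (fun z => `|g z - g y| <= C * `|z - y|); rewrite subr0 => <-.
have fg0 : \forall h \near 0, f (g (h + y)) = h + y.
  by have := near_shift 0 y (fun z => f (g z) = z); rewrite subr0 => <-.
near=> h.
have hlip : `|g (h + y) - g y| <= C * `|h|.
  by rewrite -[X in C * `|X|](addrK y); exact: (near lip0 h).
have hfg : f (g (h + y)) = h + y by exact: (near fg0 h).
set k := g (h + y) - g y in hlip.
have hr : `|h| < r / C by near: h; apply: nbhs0_lt; exact: divr_gt0.
have kr : `|k| < r by rewrite (le_lt_trans hlip)// mulrC -ltr_pdivlMr.
have := Hr k; rewrite -ball_normE/= sub0r normrN => /(_ kr).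
rewrite /k subrK hfg (nbhs_singleton fg) opprD addrA addrK => B.
have -> : g (h + y) - (g y + M h) = - M (h - 'd f (g y) k).
  by rewrite linearB/= Mdf opprB opprD addrA.
rewrite normrN (le_trans (Mc _))//.
apply: (@le_trans _ _ (c * (e / (c * C) * (C * `|h|)))).
  rewrite ler_pM2l// (le_trans B)// ler_pM2l//.
by rewrite le_eqVlt; apply/orP; left; apply/eqP; field; rewrite !gt_eqF.
Unshelve. all: by end_near. Qed.

(** If the differential kills [k], then [f] moves by [o(t)] along [t *: k], while the Lipschitz left
    inverse [g] forces it to move by at least [|t *: k| / C]. The tolerance [(2 * C)^-1] gives
    [|t *: k| <= |t *: k| / 2]. *)
Lemma differential_injective x C k : 0 < C -> differentiable f x ->
  (\forall z \near f x, `|g z - g (f x)| <= C * `|z - f x|) ->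
  (forall z, g (f z) = z) -> 'd f x k = 0 -> k = 0.
Proof.
move=> C0 df lip gf dk.
have eps0 : 0 < (2 * C)^-1 by rewrite invr_gt0 mulr_gt0.
have B := near0Z k (differentiable_bound df eps0).
have lipx : \forall z \near x, `|g (f z) - g (f x)| <= C * `|f z - f x|.
  by have := differentiable_continuous df; move=> /(_ _ lip).
have lip0 : \forall h \near 0, `|g (f (h + x)) - g (f x)| <= C * `|f (h + x) - f x|.
  have := near_shift 0 x (fun z => `|g (f z) - g (f x)| <= C * `|f z - f x|).
  by rewrite subr0 => <-.
have {}lip0 := near0Z k lip0.
near (0 : R)^' => t.
have t0 : t != 0 by near: t; exact: nbhs_dnbhs_neq.
have Bt : `|f (t *: k + x) - (f x + 'd f x (t *: k))| <= (2 * C)^-1 * `|t *: k|.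
  by near: t; exact: nbhs_dnbhs.
have Lt : `|g (f (t *: k + x)) - g (f x)| <= C * `|f (t *: k + x) - f x|.
  by near: t; exact: nbhs_dnbhs.
move: Lt Bt; rewrite !gf addrK linearZ/= dk scaler0 addr0 => Lt Bt.
have {}Bt : C * `|f (t *: k + x) - f x| <= 2^-1 * `|t *: k|.
  have -> : 2^-1 = C * (2 * C)^-1 by field; rewrite gt_eqF.
  by rewrite -mulrA ler_pM2l.
have : `|t *: k| <= 0 by have := le_trans Lt Bt; lra.
by rewrite normr_le0 scaler_eq0 (negbTE t0) => /eqP.
Unshelve. all: by end_near. Qed.

End InverseFunction.

Section LogSmooth.
Context {R : realType} {n : nat}.
Implicit Types (A B P Q : sym R n).

Definition sym_proj (X : 'M[R]_n) : sym R n := vsproj (symspace R n) X.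

Fact sym_proj_linear : linear sym_proj.
Proof. by move=> a X Y; rewrite /sym_proj linearP. Qed.

HB.instance Definition _ :=
  GRing.isLinear.Build R 'M[R]_n (sym R n) _ sym_proj sym_proj_linear.

Lemma sym_projK A : sym_proj (val A) = A.
Proof. exact: vsvalK. Qed.

Lemma smooth_symexp : smooth setT (@symexp R n).
Proof.
pose L : {linear sym R n -> 'M[R]_n} := vsval.
move=> k; apply: (Ck_eq openT (f := fun A => sym_proj (mexp (0 + L A)))).
  by move=> A _; rewrite add0r -symexp_mexp sym_projK.
apply: (Ck_linear openT); first exact: linear_continuous_mx.
apply: (@Ck_affine _ _ _ openT _ _ k setT (@mexp R n) 0 L) => //.
- exact: linear_continuous_sym.
- exact: mexp_smooth.
Qed.

(** The Lipschitz logarithm makes the differential of the exponential injective, hence invertible in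
    finite dimension, and its inverse is the differential of the logarithm. The two cancellations
    later resolve the defining equation of [procrustes_L]. *)
Lemma symlog_differential P : sympd P -> [/\ differentiable (@symlog R n) P,
  cancel ('d (@symexp R n) (symlog P)) ('d (@symlog R n) P) &
  cancel ('d (@symlog R n) P) ('d (@symexp R n) (symlog P))].
Proof.
move=> pP; have [C C0 lip] := symlog_lipschitz pP.
have dexp A : differentiable (@symexp R n) A by have [H _] := smooth_symexp 1; exact: H.
pose L : 'End(sym R n) := linfun ('d (@symexp R n) (symlog P)).
have LE x : L x = 'd (@symexp R n) (symlog P) x by rewrite lfunE.
have inj0 x : 'd (@symexp R n) (symlog P) x = 0 -> x = 0.
  apply: (differential_injective C0 (dexp (symlog P)) _ (@symexpK R n)).
  by rewrite symlogK.
have kL : lker L == 0%VS.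
  apply/lker0P => x y; rewrite !LE => xy; apply/eqP; rewrite -subr_eq0; apply/eqP.
  by apply: inj0; rewrite linearB/= xy subrr.
have LK := lker0_lfunK kL; have LVK := lker0_lfunVK kL.
pose M : {linear sym R n -> sym R n} := (L^-1)%VF.
have [dl dlE] : differentiable (@symlog R n) P /\ 'd (@symlog R n) P = M :> (_ -> _).
  apply: (inverse_differentiable C0 _ (dexp _) _ lip).
  - exact: linear_continuous_sym.
  - by move=> k; rewrite -LE; exact: LK.
  - by apply: (open_near (@open_sympd R n) pP) => Q; exact: symlogK.
have dlx x : 'd (@symlog R n) P x = M x by exact: (congr1 (fun F : _ -> _ => F x) dlE).
split=> [//|x|x].
- exact: (etrans (dlx _) (etrans (congr1 M (esym (LE x))) (LK x))).
- exact: (etrans (congr1 _ (dlx x)) (etrans (esym (LE _)) (LVK x))).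
Qed.

(** Bootstrap: ['D_v symlog q] solves a linear system with matrix ['d symexp (symlog q)]. If the
    logarithm is C^k, so are the coefficients, hence by Cramer's rule the solution, and the
    logarithm is C^(k+1). *)
Lemma smooth_symlog : smooth (@sympd R n) (@symlog R n).
Proof.
have oS := @open_sympd R n; have [m [e [c ec]]] := @sym_coordinates R n.
elim=> [|k IH].
  move=> P pP; apply: differentiable_continuous.
  by have [] := symlog_differential pP.
split=> [P pP|v]; first by have [] := symlog_differential pP.
apply: (Ck_solve oS (A := fun q => 'd (@symexp R n) (symlog q)) (F := fun=> v) ec).
- by move=> q _ a x y; rewrite linearP.
- move=> q w pq /= dw; have [_ K _] := symlog_differential pq.
  by apply: (can_inj K); rewrite dw linear0.
- move=> j; apply: (Ck_eq oS (f := fun q => 'D_(e j) (@symexp R n) (symlog q))).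
    by move=> q _; rewrite deriveE//; have [H _] := smooth_symexp 1; exact: H.
  have [_ Dexp] := smooth_symexp k.+1.
  exact: (Ck_comp oS (U' := setT) ec (fun _ _ => I) IH (Dexp (e j))).
- exact: Ck_cst.
- move=> q pq; have [dl _ K] := symlog_differential pq.
  by rewrite deriveE.
Qed.

End LogSmooth.

(** * Curvature of a metric in a chart *)

Section LinearDerivative.
Context {R : realType} {V W X : normedModType R}.

Lemma derive_linear (L : {linear W -> X}) (f : V -> W) q : continuous L ->
  differentiable f q -> differentiable (fun x => L (f x)) q /\
  forall v, 'D_v (fun x => L (f x)) q = L ('D_v f q).
Proof.
move=> cL df; have dL x : differentiable L x by exact: linear_differentiable.
have dc := differentiable_comp df (dL (f q)).
split=> // v; rewrite (deriveE v df) [LHS]deriveE; last exact: dc.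
by rewrite (diff_comp df (dL (f q)))/= diff_lin.
Qed.

End LinearDerivative.

Section VectorMixedDerivatives.
Context {R : realType} {V W : normedModType R}.

Lemma derive_comm_coord m (e : 'I_m -> W) (c : 'I_m -> {linear W -> R}) (U : set V)
    (f : V -> W) p u v : coordinates e c -> open U -> Ck 2 U f -> U p ->
  'D_v (fun q => 'D_u f q) p = 'D_u (fun q => 'D_v f q) p.
Proof.
move=> ec oU cf Up; apply: (coord_inj ec) => i; have [cc _ _] := ec.
have [df Df] := cf; have [dDu _] := Df u; have [dDv _] := Df v.
have DE w q : U q -> 'D_w (fun x => c i (f x)) q = c i ('D_w f q).
  by move=> Uq; have [_] := derive_linear (cc i) (df q Uq).
have [_ <-] := derive_linear (cc i) (dDu p Up).
have [_ <-] := derive_linear (cc i) (dDv p Up).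
transitivity ('D_v (fun q => 'D_u (fun x => c i (f x)) q) p).
  by apply: near_eq_derive; apply: (open_near oU Up) => q Uq; rewrite DE.
rewrite (derive_comm _ _ oU (Ck_linear oU (cc i) cf) Up).
by apply: near_eq_derive; apply: (open_near oU Up) => q Uq; rewrite DE.
Qed.

End VectorMixedDerivatives.

Section RealArithmetic.
Context {R : realType}.
Implicit Types x y z w A B C : R.

Lemma half_diff x A B : 2 * x = A + A - B -> A - 2^-1 * B = x.
Proof. lra. Qed.

Lemma half_cancel x A B : 2 * x = B + A - B -> 2^-1 * A = x.
Proof. lra. Qed.

Lemma half_sum x y A B C : 2 * x = A + B - C -> 2 * y = A + C - B -> A = x + y.
Proof. lra. Qed.

Lemma curvature_regroup x y z w A B C (D : R) : A = x + z -> B = y + w ->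
  x + C - (y + D) = A + C - (B + D) - z + w.
Proof. by move=> -> ->; ring. Qed.

End RealArithmetic.

Section LeviCivita.
Context {R : realType} {V : normedModType R} {m : nat}.
Variables (e : 'I_m -> V) (c : 'I_m -> {linear V -> R}) (U : set V)
  (g : V -> V -> V -> R).
Hypotheses (ec : coordinates e c) (oU : open U).
Hypothesis gC : forall q x y, U q -> g q x y = g q y x.
Hypothesis gP : forall q a x x' y, U q -> g q (a *: x + x') y = a * g q x y + g q x' y.
Hypothesis g_nondegenerate : forall q w, U q -> (forall z, g q w z = 0) -> w = 0.
Hypothesis g_C2 : forall x y, Ck 2 U (fun q => g q x y).

Definition dmetric q u x y : R := 'D_u (fun p => g p x y) q.

Lemma metric0 q y : U q -> g q 0 y = 0.
Proof. by move=> Uq; have := gP 1 0 0 y Uq; rewrite scaler0 add0r mul1r; lra. Qed.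

Lemma metricD q x x' y : U q -> g q (x + x') y = g q x y + g q x' y.
Proof. by move=> Uq; have := gP 1 x x' y Uq; rewrite scale1r mul1r. Qed.

Lemma metricZ q a x y : U q -> g q (a *: x) y = a * g q x y.
Proof. by move=> Uq; have := gP a x 0 y Uq; rewrite metric0// !addr0. Qed.

Lemma metricN q x y : U q -> g q (- x) y = - g q x y.
Proof. by move=> Uq; rewrite -scaleN1r metricZ// mulN1r. Qed.

Lemma metric_sum q x y : U q -> g q x y = \sum_i c i x * g q (e i) y.
Proof.
move=> Uq; have [_ _ E] := ec; rewrite {1}[x]E.
elim/big_ind2 : _ => [|x1 x2 y1 y2 <- <-|i _]; first exact: metric0.
  exact: metricD.
exact: metricZ.
Qed.

Lemma metric_differentiable q x y : U q -> differentiable (fun p => g p x y) q.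
Proof. by move=> Uq; have [H _] := g_C2 x y; exact: H. Qed.

Lemma metric_derive_sum Y z q : U q -> differentiable Y q ->
  differentiable (fun p => g p (Y p) z) q /\
  forall u, 'D_u (fun p => g p (Y p) z) q =
    \sum_i (c i (Y q) * dmetric q u (e i) z + g q (e i) z * c i ('D_u Y q)).
Proof.
move=> Uq dY; have [cc _ _] := ec.
pose h i p := c i (Y p) * g p (e i) z.
have dh i : differentiable (h i) q.
  by apply: differentiableM; [exact: (derive_linear (cc i) dY).1|exact: metric_differentiable].
have hE : \forall p \near q, (\sum_i h i) p = g p (Y p) z.
  by apply: (open_near oU Uq) => p Up; rewrite fct_sumE [RHS]metric_sum.
split.
  apply: near_eq_differentiable hE _; exact: differentiable_sum.
move=> u; rewrite -(near_eq_derive u hE) derive_sum; last first.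
  by move=> i; exact: diff_derivable.
apply: eq_bigr => i _; rewrite deriveM.
- by have [_ ->] := derive_linear (cc i) dY.
- exact: diff_derivable (derive_linear (cc i) dY).1.
- exact: diff_derivable (metric_differentiable _ _ Uq).
Qed.

Lemma metric_derive Y z q : U q -> differentiable Y q ->
  forall u, 'D_u (fun p => g p (Y p) z) q = dmetric q u (Y q) z + g q ('D_u Y q) z.
Proof.
move=> Uq dY u; have [_ ->] := metric_derive_sum z Uq dY.
rewrite big_split/=; congr (_ + _).
  have [_ /(_ u)] := metric_derive_sum z Uq (differentiable_cst (Y q) q).
  rewrite /dmetric => ->; apply: eq_bigr => i _.
  by rewrite derive_cst linear0 mulr0 addr0.
by rewrite [RHS]metric_sum//; apply: eq_bigr => i _; rewrite mulrC.
Qed.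

Lemma metric_deriver Y z q : U q -> differentiable Y q ->
  forall u, 'D_u (fun p => g p z (Y p)) q = dmetric q u (Y q) z + g q ('D_u Y q) z.
Proof.
move=> Uq dY u; rewrite -metric_derive//; apply: near_eq_derive.
by apply: (open_near oU Uq) => p Up; exact: gC.
Qed.

Lemma dmetricC q u x y : U q -> dmetric q u x y = dmetric q u y x.
Proof.
by move=> Uq; apply: near_eq_derive; apply: (open_near oU Uq) => p Up; exact: gC.
Qed.

Lemma dmetric_suml q u x y : U q -> dmetric q u x y = \sum_i c i x * dmetric q u (e i) y.
Proof.
move=> Uq; have [_ /(_ u)] := metric_derive_sum y Uq (differentiable_cst x q).
rewrite /dmetric => ->; apply: eq_bigr => i _.
by rewrite derive_cst linear0 mulr0 addr0.
Qed.

Lemma dmetric_sumr q u x y : U q -> dmetric q u x y = \sum_i c i y * dmetric q u x (e i).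
Proof.
move=> Uq; rewrite dmetricC// dmetric_suml//; apply: eq_bigr => i _.
by rewrite dmetricC.
Qed.

Lemma dmetric_sum q u x y : U q -> dmetric q u x y = \sum_i c i u * dmetric q (e i) x y.
Proof.
move=> Uq; have [_ _ E] := ec; have df := metric_differentiable x y Uq.
rewrite /dmetric deriveE// {1}[u]E linear_sum; apply: eq_bigr => i _.
by rewrite linearZ/= deriveE.
Qed.

Lemma dmetric0 q x y : U q -> dmetric q 0 x y = 0.
Proof. by move=> Uq; rewrite /dmetric derive0. Qed.

(** Lowering an index. The components of the covector are reassembled into a vector of [V], so that
    the results on linear endomorphisms apply. *)
Definition lower q (w : V) : V := \sum_i g q w (e i) *: e i.

Lemma lower_linear q : U q -> linear (lower q).
Proof.
move=> Uq a x y; rewrite /lower scaler_sumr -big_split; apply: eq_bigr => i _.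
by rewrite gP// scalerDl scalerA.
Qed.

Lemma lower_inj q w : U q -> lower q w = 0 -> w = 0.
Proof.
move=> Uq lw; apply: (g_nondegenerate Uq) => z.
rewrite gC// metric_sum// big1// => i _.
by rewrite gC// -(coord_basis_sum ec (fun i => g q w (e i))) [\sum_i _]lw linear0 mulr0.
Qed.

Definition christoffel v w : V -> V := levi_civita g (cst v) (cst w).

Lemma lie_bracket_cst (u v : V) : lie_bracket (cst u) (cst v) = cst 0.
Proof. by apply/funext => p; rewrite /lie_bracket !derive_cst subrr. Qed.

Lemma koszul_cst u v w q : U q -> koszul g (cst u) (cst v) (cst w) q =
  dmetric q u v w + dmetric q v w u - dmetric q w u v.
Proof.
by move=> Uq; rewrite /koszul !lie_bracket_cst /= !metric0// subr0 !addr0.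
Qed.

Lemma levi_civita_eq X Y q W : U q -> (forall z, 2 * g q W z = koszul g X Y (cst z) q) ->
  levi_civita g X Y q = W.
Proof.
move=> Uq HW; rewrite /levi_civita; case: xgetP => [W' _ HW'|]; last by move/(_ W).
apply/eqP; rewrite -subr_eq0; apply/eqP/(g_nondegenerate Uq) => z.
by rewrite metricD// metricN//; have := HW z; rewrite -HW'; lra.
Qed.

(** Existence has to be shown, since otherwise the choice in [levi_civita] would return its default
    [0]. The right-hand side is linear in [z], and [lower], being injective, represents it by a
    vector. *)
Lemma christoffelP v w q : U q -> forall z, 2 * g q (christoffel v w q) z =
  dmetric q v w z + dmetric q w z v - dmetric q z v w.
Proof.
move=> Uq.
pose phi z := dmetric q v w z + dmetric q w z v - dmetric q z v w.
have phiE z : phi z = \sum_i c i z * phi (e i).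
  rewrite /phi dmetric_sumr// [dmetric q w z v]dmetric_suml// [dmetric q z v w]dmetric_sum//.
  by rewrite -big_split -sumrB; apply: eq_bigr => i _ /=; ring.
have [W HW] := linear_injective_surjective ec (lower_linear Uq)
  (fun w => @lower_inj q w Uq) (\sum_i (2^-1 * phi (e i)) *: e i).
have gW z : 2 * g q W z = phi z.
  rewrite gC// metric_sum// phiE mulr_sumr; apply: eq_bigr => i _.
  have := congr1 (c i) HW; rewrite !(coord_basis_sum ec) gC// => ->.
  by field.
rewrite /christoffel (@levi_civita_eq _ _ q W) // => z.
by rewrite koszul_cst// gW.
Qed.

Lemma christoffelC v w q : U q -> christoffel v w q = christoffel w v q.
Proof.
move=> Uq; apply/eqP; rewrite -subr_eq0; apply/eqP/(g_nondegenerate Uq) => z.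
rewrite metricD// metricN//; have := christoffelP v w Uq z; have := christoffelP w v Uq z.
by rewrite [dmetric q w z v]dmetricC// [dmetric q v z w]dmetricC// [dmetric q z w v]dmetricC//; lra.
Qed.

Lemma christoffel_C1 v w : Ck 1 U (christoffel v w).
Proof.
have DC x y u : Ck 1 U (fun q => dmetric q u x y) by have [_ H] := g_C2 x y; exact: H.
apply: (Ck_solve oU (A := lower) (F := fun q => \sum_i (2^-1 * (dmetric q v w (e i) +
  dmetric q w (e i) v - dmetric q (e i) v w)) *: e i) ec lower_linear).
- by move=> q w'; exact: lower_inj.
- move=> j; apply: Ck_sum => // i _; apply: Ck_scale => //; last exact: Ck_cst.
  exact: Ck_pred (g_C2 _ _).
- apply: Ck_sum => // i _; apply: Ck_scale => //; last exact: Ck_cst.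
  apply: CkM => //; first exact: Ck_cst.
  by apply: CkB => //; apply: CkD.
- move=> q Uq; apply: eq_bigr => i _; rewrite -christoffelP//.
  by rewrite mulKf// pnatr_eq0.
Qed.

Lemma levi_civita_cst u Y q : U q -> differentiable Y q ->
  levi_civita g (cst u) Y q = christoffel u (Y q) q + 'D_u Y q.
Proof.
move=> Uq dY; apply: levi_civita_eq => // z.
have E1 := metric_derive z Uq dY u; have E2 := metric_deriver u Uq dY z.
rewrite /koszul lie_bracket_cst /lie_bracket !derive_cst/= subr0 sub0r.
rewrite metric0// addr0 E1 E2 -/(dmetric q (Y q) z u) metricN//.
rewrite metricD// mulrDr christoffelP// [dmetric q z (Y q) u]dmetricC//.
by ring.
Qed.

Lemma riemann_tensorE p u v w : U p -> riemann_tensor g p u v w =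
  christoffel u (christoffel v w p) p + 'D_u (christoffel v w) p
  - (christoffel v (christoffel u w p) p + 'D_v (christoffel u w) p).
Proof.
move=> Up; rewrite /riemann_tensor /curvature_field.
have dG x y : differentiable (christoffel x y) p.
  by have [H _] := christoffel_C1 x y; exact: H.
rewrite -/(christoffel v w) -/(christoffel u w) (levi_civita_cst u Up (dG v w)).
rewrite (levi_civita_cst v Up (dG u w)).
have -> : levi_civita g (lie_bracket (cst u) (cst v)) (cst w) p = 0.
  rewrite lie_bracket_cst; apply: levi_civita_eq => // z.
  rewrite koszul_cst// dmetric0// metric0// add0r mulr0.
  have H0 x y : dmetric p x 0 y = 0.
    by rewrite dmetric_suml// big1// => i _; rewrite linear0 mul0r.
  by rewrite [dmetric p w z 0]dmetricC// !H0 subrr.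
by rewrite subr0.
Qed.

(** Derivatives of Christoffel fields are traded for derivatives of the metric: the lowered symbols
    [g (christoffel v v) u] and [g (christoffel u v) u] are combinations of [dmetric], and
    differentiating them gives the wanted term plus one in which the metric is differentiated.
    Compatibility of the connection with the metric turns the latter into products of Christoffel
    fields. *)
Lemma curvature_numerator p u v : U p ->
  g p (riemann_tensor g p u v v) u =
    'D_u (fun q => dmetric q v v u) p - 2^-1 * 'D_u (fun q => dmetric q u v v) p
    - 2^-1 * 'D_v (fun q => dmetric q v u u) p
    - g p (christoffel u u p) (christoffel v v p)
    + g p (christoffel u v p) (christoffel u v p).
Proof.
move=> Up; rewrite riemann_tensorE//.
have dG x y : differentiable (christoffel x y) p.
  by have [H _] := christoffel_C1 x y; exact: H.
have dD x y z : derivable (fun q => dmetric q x y z) p u /\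
    derivable (fun q => dmetric q x y z) p v.
  have [_ /(_ x) [H _]] := g_C2 y z.
  by split; apply: diff_derivable; exact: H.
have E1 : 'D_u (fun q => dmetric q v v u) p - 2^-1 * 'D_u (fun q => dmetric q u v v) p =
    dmetric p u (christoffel v v p) u + g p ('D_u (christoffel v v) p) u.
  rewrite -metric_derive// -[2^-1 * _]/(2^-1 *: _).
  rewrite -deriveZ; last exact: (dD _ _ _).1.
  rewrite -deriveB; [|exact: (dD _ _ _).1|by apply: derivableZ; exact: (dD _ _ _).1].
  apply: near_eq_derive; apply: (open_near oU Up) => q Uq.
  by have := christoffelP v v Uq u; rewrite (dmetricC v u v Uq); exact: half_diff.
have E2 : 2^-1 * 'D_v (fun q => dmetric q v u u) p =
    dmetric p v (christoffel u v p) u + g p ('D_v (christoffel u v) p) u.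
  rewrite -metric_derive// -[2^-1 * _]/(2^-1 *: _).
  rewrite -deriveZ; last exact: (dD _ _ _).2.
  apply: near_eq_derive; apply: (open_near oU Up) => q Uq.
  by have := christoffelP u v Uq u; rewrite (dmetricC u v u Uq); exact: half_cancel.
have compat x y z : dmetric p x y z = g p (christoffel x y p) z + g p (christoffel x z p) y.
  have H1 := christoffelP x y Up z; have := christoffelP x z Up y.
  rewrite (dmetricC x z y Up) (dmetricC z y x Up) (dmetricC y x z Up) => H2.
  exact: half_sum H1 H2.
rewrite E1 E2 !metricD// metricN// metricD//.
have C1 := compat u (christoffel v v p) u; have := compat v (christoffel u v p) u.
rewrite (christoffelC v u Up) => C2.
exact: curvature_regroup C1 C2.
Qed.

End LeviCivita.

(** [A] and [F] stand for pairings with third derivatives of [T], [M] and [C] for products of its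
    second derivatives, and [B] for the square of [D_v (N u)]. Everything but [3 * B] cancels. *)
Lemma curvature_arith (R : realType) (A A' F F' M M' C B Bm Bmm : R) :
  F' = F -> A' = A -> M' = M -> Bm = - B -> Bmm = B -> 0 <= B ->
  0 <= A + M + C + F - 0 - Bm - 2^-1 * (F' + C + C + F - B - B)
    - 2^-1 * (A + C + C + A' - Bmm - Bmm) - M' + C.
Proof. by move=> -> -> -> -> -> B0; lra. Qed.

(* The metric is the pull-back of the constant form [b] by [T], minus the square of
   a field [N] that vanishes at [p]. *)
Section FlatMinusSquare.
Context {R : realType} {V W : normedModType R} {m mW : nat}.
Variables (e : 'I_m -> V) (c : 'I_m -> {linear V -> R}).
Variables (eW : 'I_mW -> W) (cW : 'I_mW -> {linear W -> R}).
Variables (U : set V) (g : V -> V -> V -> R) (b : {bilinear W -> W -> R}).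
Variables (T : V -> W) (N : V -> V -> W) (p : V).
Hypotheses (ec : coordinates e c) (ecW : coordinates eW cW) (oU : open U).
Hypotheses (cb : continuous (fun x => b x.1 x.2)) (bC : forall x y, b x y = b y x)
  (b_ge0 : forall x, 0 <= b x x).
Hypotheses (T_C3 : Ck 3 U T) (N_C2 : forall x, Ck 2 U (fun q => N q x)).
Hypothesis N_linear : forall q, U q -> linear (N q).
Hypothesis gE : forall q x y, U q ->
  g q x y = b ('D_x T q) ('D_y T q) - b (N q x) (N q y).
Hypothesis g_nondegenerate : forall q w, U q -> (forall z, g q w z = 0) -> w = 0.
Hypotheses (Up : U p) (N0 : forall x, N p x = 0)
  (N_skew : forall u v, 'D_u (fun q => N q v) p = - 'D_v (fun q => N q u) p)
  (T_surj : forall u v, exists x, 'D_x T p = 'D_u (fun q => 'D_v T q) p).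

Let T_diff q : U q -> differentiable T q.
Proof. by have [H _] := T_C3; exact: H. Qed.

Let DT_C2 v : Ck 2 U (fun q => 'D_v T q).
Proof. by have [_ H] := T_C3; exact: H. Qed.

Let DT_diff v q : U q -> differentiable (fun q => 'D_v T q) q.
Proof. by have [H _] := DT_C2 v; exact: H. Qed.

Let DDT_diff u v q : U q -> differentiable (fun q => 'D_u (fun q => 'D_v T q) q) q.
Proof. by have [_ /(_ u) [H _]] := DT_C2 v; exact: H. Qed.

Let N_diff v q : U q -> differentiable (fun q => N q v) q.
Proof. by have [H _] := N_C2 v; exact: H. Qed.

Let DN_diff u v q : U q -> differentiable (fun q => 'D_u (fun q => N q v) q) q.
Proof. by have [_ /(_ u) [H _]] := N_C2 v; exact: H. Qed.

Let gC q x y : U q -> g q x y = g q y x.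
Proof. by move=> Uq; rewrite !gE// bC [b (N _ _) _]bC. Qed.

Let gP q a x x' y : U q -> g q (a *: x + x') y = a * g q x y + g q x' y.
Proof.
move=> Uq; rewrite !gE// !(deriveE _ (T_diff Uq)) N_linear// linearP !linearDl !linearZl_LR/=.
by rewrite -![_ *: _]/(_ * _); ring.
Qed.

Let g_C2 x y : Ck 2 U (fun q => g q x y).
Proof.
apply: (Ck_eq oU (f := fun q => b ('D_x T q) ('D_y T q) - b (N q x) (N q y))).
  by move=> q Uq; rewrite gE.
by apply: CkB => //; apply: Ck_bilinear.
Qed.

Let D_bilinear (f h : V -> W) q u : differentiable f q -> differentiable h q ->
  'D_u (fun q => b (f q) (h q)) q = b ('D_u f q) (h q) + b (f q) ('D_u h q).
Proof. by move=> df dh; have [_ ->] := derive_bilinear cb df dh; rewrite addrC. Qed.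

Let b_derivable (f h : V -> W) q u : differentiable f q -> differentiable h q ->
  derivable (fun q => b (f q) (h q)) q u.
Proof. by move=> df dh; apply: diff_derivable; have [] := derive_bilinear cb df dh. Qed.

Lemma dmetricE q u x y : U q -> dmetric g q u x y =
  (b ('D_u (fun q => 'D_x T q) q) ('D_y T q) + b ('D_x T q) ('D_u (fun q => 'D_y T q) q))
  - (b ('D_u (fun q => N q x) q) (N q y) + b (N q x) ('D_u (fun q => N q y) q)).
Proof.
move=> Uq; rewrite /dmetric.
have -> : 'D_u (fun q => g q x y) q =
    'D_u (fun q => b ('D_x T q) ('D_y T q) - b (N q x) (N q y)) q.
  by apply: near_eq_derive; apply: (open_near oU Uq) => q' Uq'; rewrite gE.
rewrite deriveB; [|exact: b_derivable (DT_diff _ Uq) (DT_diff _ Uq)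
                  |exact: b_derivable (N_diff _ Uq) (N_diff _ Uq)].
by rewrite !D_bilinear//; [exact: N_diff|exact: N_diff|exact: DT_diff|exact: DT_diff].
Qed.

(** Since [N] vanishes at [p], its second derivatives are paired with zero, and only products of its
    first derivatives survive. *)
Lemma derive_dmetricE w u x y : 'D_w (fun q => dmetric g q u x y) p =
  b ('D_w (fun q => 'D_u (fun q => 'D_x T q) q) p) ('D_y T p)
  + b ('D_u (fun q => 'D_x T q) p) ('D_w (fun q => 'D_y T q) p)
  + b ('D_w (fun q => 'D_x T q) p) ('D_u (fun q => 'D_y T q) p)
  + b ('D_x T p) ('D_w (fun q => 'D_u (fun q => 'D_y T q) q) p)
  - b ('D_u (fun q => N q x) p) ('D_w (fun q => N q y) p)
  - b ('D_w (fun q => N q x) p) ('D_u (fun q => N q y) p).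
Proof.
pose b1 q := b ('D_u (fun q => 'D_x T q) q) ('D_y T q).
pose b2 q := b ('D_x T q) ('D_u (fun q => 'D_y T q) q).
pose b3 q := b ('D_u (fun q => N q x) q) (N q y).
pose b4 q := b (N q x) ('D_u (fun q => N q y) q).
have -> : 'D_w (fun q => dmetric g q u x y) p = 'D_w ((b1 + b2) - (b3 + b4)) p.
  by apply: near_eq_derive; apply: (open_near oU Up) => q Uq; rewrite dmetricE.
have d1 : derivable b1 p w by apply: b_derivable; [exact: DDT_diff|exact: DT_diff].
have d2 : derivable b2 p w by apply: b_derivable; [exact: DT_diff|exact: DDT_diff].
have d3 : derivable b3 p w by apply: b_derivable; [exact: DN_diff|exact: N_diff].
have d4 : derivable b4 p w by apply: b_derivable; [exact: N_diff|exact: DN_diff].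
rewrite deriveB; [|exact: derivableD|exact: derivableD].
rewrite !deriveD// /b1 /b2 /b3 /b4.
rewrite (D_bilinear _ (DDT_diff _ _ Up) (DT_diff _ Up)).
rewrite (D_bilinear _ (DT_diff _ Up) (DDT_diff _ _ Up)).
rewrite (D_bilinear _ (DN_diff _ _ Up) (N_diff _ Up)).
rewrite (D_bilinear _ (N_diff _ Up) (DN_diff _ _ Up)).
have aux (a1 a2 a3 a4 z1 c1 c2 z2 : R) : z1 = 0 -> z2 = 0 ->
  a1 + a2 + (a3 + a4) - (z1 + c1 + (c2 + z2)) = a1 + a2 + a3 + a4 - c1 - c2.
  by move=> -> ->; ring.
by apply: aux; rewrite N0 ?linear0r ?linear0l.
Qed.

Let DD_comm u v q : U q ->
  'D_v (fun q => 'D_u T q) q = 'D_u (fun q => 'D_v T q) q.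
Proof. by move=> Uq; apply: (derive_comm_coord _ _ ecW oU _ Uq); exact: Ck_pred T_C3. Qed.

(** The first derivatives of the metric at [p] do not see [N], so the Christoffel field is that of
    the pulled-back form. In general it would give only the projection of [D_u D_v T] to the range
    of [D T]; by [T_surj] there is no normal component, that is, no second fundamental form. *)
Lemma christoffel_second_derivative u v :
  'D_(christoffel g u v p) T p = 'D_u (fun q => 'D_v T q) p.
Proof.
have [x Tx] := T_surj u v; rewrite -Tx; congr ('D_ _ T p).
apply/eqP; rewrite -subr_eq0; apply/eqP/(g_nondegenerate Up) => z.
have := christoffelP ec oU gC gP g_nondegenerate g_C2 u v Up z.
have dE w y y' : dmetric g p w y y' = b ('D_w (fun q => 'D_y T q) p) ('D_y' T p)
    + b ('D_y T p) ('D_w (fun q => 'D_y' T q) p).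
  by rewrite dmetricE// (N0 y) (N0 y') linear0r linear0l addr0 subr0.
rewrite (dE u v z) (dE v z u) (dE z u v).
rewrite (DD_comm u v Up) (DD_comm z v Up) (DD_comm z u Up).
rewrite [b ('D_v T p) _]bC [b ('D_u T p) _]bC.
rewrite [b ('D_z T p) _]bC -Tx.
have -> : b ('D_x T p) ('D_z T p) = g p x z by rewrite gE// !N0 linear0l subr0.
rewrite (metricD gP)// (metricN gP)//; lra.
Qed.

Lemma cauchy_schwarz_semidefinite x y : b x y ^+ 2 <= b x x * b y y.
Proof.
have H s t : 0 <= s ^+ 2 * b x x + 2 * s * t * b x y + t ^+ 2 * b y y.
  have := b_ge0 (s *: x + t *: y).
  rewrite linearDl !linearDr !linearZl_LR !linearZr_LR/= [b y x]bC -![_ *: _]/(_ * _).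
  by congr (_ <= _); ring.
have [y0|y0] := eqVneq (b y y) 0.
  have := H 1 (- (b x x + 1) * b x y); rewrite y0.
  (* For [b y y = 0] this instance reads [0 <= - (b x x + 2) * b x y ^+ 2], hence [b x y = 0]. *)
  have := H (b x y) (- (b x x + 1)); rewrite y0.
  have := b_ge0 x; nra.
have yy : 0 < b y y by rewrite lt_neqAle eq_sym y0 b_ge0.
have := H (b y y) (- b x y) => {}H.
rewrite -subr_ge0 -(pmulr_rge0 _ yy); move: H; congr (_ <= _); ring.
Qed.

Lemma sectional_curvature_ge0 u v : 0 <= sectional_curvature g p u v.
Proof.
(* The inverse of [0] is [0], so the Gram determinant is only shown to be nonnegative. *)
rewrite /sectional_curvature mulr_ge0 ?invr_ge0//; last first.
  by rewrite !gE// !N0 !linear0l !subr0 subr_ge0 cauchy_schwarz_semidefinite.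
rewrite (curvature_numerator ec oU gC gP g_nondegenerate g_C2)// !derive_dmetricE.
rewrite !gE// !christoffel_second_derivative !N0 !linear0l !subr0.
have Nuu w : 'D_w (fun q => N q w) p = 0.
  have /eqP := N_skew w w; rewrite -addr_eq0 -mulr2n -scaler_nat scaler_eq0 pnatr_eq0/=.
  by move=> /eqP.
(* The third derivatives of [T] are brought to a common order of differentiation so that they cancel
   between the three terms. *)
have uvv : 'D_u (fun q => 'D_v (fun q => 'D_v T q) q) p =
    'D_v (fun q => 'D_v (fun q => 'D_u T q) q) p.
  rewrite -(derive_comm_coord _ _ ecW oU (DT_C2 v) Up); apply: near_eq_derive.
  by apply: (open_near oU Up) => q Uq; rewrite DD_comm.
have uvu : 'D_u (fun q => 'D_v (fun q => 'D_u T q) q) p =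
    'D_u (fun q => 'D_u (fun q => 'D_v T q) q) p.
  by apply: near_eq_derive; apply: (open_near oU Up) => q Uq; rewrite DD_comm.
rewrite uvv uvu !Nuu (DD_comm u v Up) (N_skew v u) !linear0l ?linear0r.
apply: curvature_arith; [exact: bC|exact: bC|exact: bC| | |exact: b_ge0].
- exact: linearNr.
- by rewrite linearNl linearNr opprK.
Qed.

End FlatMinusSquare.

(** * The alpha-Procrustes metric *)

Section MatrixForms.
Context {R : realType} {n : nat}.

Lemma mx_coordinates : exists m (e : 'I_m -> 'M[R]_n) (c : 'I_m -> {linear 'M[R]_n -> R}),
  coordinates e c.
Proof.
have lin k : linear (fun A : 'M[R]_n => mxvec A 0 k : R^o).
  by move=> a A B; rewrite linearP !mxE.
pose c k : {linear 'M[R]_n -> R^o} :=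
  HB.pack (fun A : 'M[R]_n => mxvec A 0 k : R^o) (GRing.isLinear.Build R _ _ _ _ (lin k)).
exists (n * n)%N, (fun k => vec_mx (delta_mx 0 k)), c; split=> [k|i j|A].
- exact: linear_continuous_mx.
- by rewrite /c/= vec_mxK mxE eqxx.
- rewrite -[LHS]mxvecK [X in vec_mx X]row_sum_delta linear_sum.
  by apply: eq_bigr => k _; rewrite linearZ.
Qed.

Definition trace_form (k : R) (Q : 'M[R]_n) (A B : 'M[R]_n) : R^o := k * \tr (A *m Q *m B^T).

Fact trace_form_bilinear k Q : bilinear_for
  (GRing.Scale.Law.clone _ _ *:%R _) (GRing.Scale.Law.clone _ _ *:%R _) (trace_form k Q).
Proof.
split=> [u'|u] a x y; rewrite /trace_form.
  by rewrite !mulmxDl linearD/= -!scalemxAl linearZ/= mulrDr [LHS]/= mulrCA.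
by rewrite linearD linearZ/= mulmxDr linearD/= -scalemxAr linearZ/= mulrDr [LHS]/= mulrCA.
Qed.

HB.instance Definition _ k Q := bilinear_isBilinear.Build R 'M[R]_n 'M[R]_n R^o _ _
  (trace_form k Q) (trace_form_bilinear k Q).

Lemma trace_form_continuous k Q : continuous (fun x => trace_form k Q x.1 x.2).
Proof.
have linL : linear (fun A : 'M[R]_n => Q *m A^T).
  by move=> a A B; rewrite linearP/= mulmxDr scalemxAr.
pose L : {linear 'M[R]_n -> 'M[R]_n} := HB.pack (fun A : 'M[R]_n => Q *m A^T)
  (GRing.isLinear.Build R _ _ _ _ linL).
have lint : linear (fun A : 'M[R]_n => k * \tr A : R^o).
  by move=> a A B; rewrite linearP/= mulrDr mulrCA.
pose t : {linear 'M[R]_n -> R^o} := HB.pack (fun A : 'M[R]_n => k * \tr A : R^o)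
  (GRing.isLinear.Build R _ _ _ _ lint).
pose MM := ('M[R]_n * 'M[R]_n)%type.
have -> : (fun x : MM => trace_form k Q x.1 x.2) =
    t \o (fun y : MM => y.1 *m y.2) \o (fun x : MM => (x.1, L x.2)).
  by apply/funext => x /=; rewrite /trace_form mulmxA.
move=> x; apply: continuous_comp; last first.
  by apply: continuous_comp; [exact: mulmx_continuous|exact: linear_continuous_mx].
apply: (@cvg_pair _ _ _ _ (nbhs x.1) (nbhs (L x.2)) _ _ _ fst (fun y : MM => L y.2)).
  exact: cvg_fst.
apply: (@continuous_comp _ _ _ (fun y : MM => y.2) L); first exact: cvg_snd.
exact: linear_continuous_mx.
Qed.

Lemma derive_mulmx (V : normedModType R) (f h : V -> 'M[R]_n) q :
  differentiable f q -> differentiable h q ->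
  differentiable (fun x => f x *m h x) q /\
  forall v, 'D_v (fun x => f x *m h x) q = 'D_v f q *m h q + f q *m 'D_v h q.
Proof.
move=> df dh; have [d D] := derive_bilinear (b := mulmx) (@mulmx_continuous R n n n) df dh.
by split=> // v; rewrite D addrC.
Qed.

Lemma Ck_mulmx (V : normedModType R) k (U : set V) (f h : V -> 'M[R]_n) : open U ->
  Ck k U f -> Ck k U h -> Ck k U (fun x => f x *m h x).
Proof. by move=> oU; apply: (Ck_bilinear oU (b := mulmx)); exact: mulmx_continuous. Qed.

Lemma trace_formC k (Q A B : 'M[R]_n) : Q^T = Q -> trace_form k Q A B = trace_form k Q B A.
Proof.
move=> QT; rewrite /trace_form -[in LHS]mxtrace_tr !trmx_mul trmxK QT mulmxA //.
Qed.

Lemma conj_diag_entry (A Q : 'M[R]_n) i :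
  (A *m Q *m A^T) i i = (row i A *m Q *m (row i A)^T) 0 0.
Proof.
rewrite mxE [RHS]mxE; apply: eq_bigr => j _.
by rewrite -row_mul [X in _ = X * _]mxE [A^T _ _]mxE [(row i A)^T _ _]mxE [row i A _ _]mxE.
Qed.

Lemma sympd_ge0 (Q : sym R n) (x : 'rV[R]_n) : sympd Q -> 0 <= (x *m val Q *m x^T) 0 0.
Proof.
by move=> pQ; have [->|x0] := eqVneq x 0; [rewrite !mul0mx mxE|exact/ltW/pQ].
Qed.

Lemma trace_form_ge0 k (Q : sym R n) (A : 'M[R]_n) : 0 <= k -> sympd Q ->
  0 <= trace_form k (val Q) A A.
Proof.
move=> k0 pQ; rewrite /trace_form mulr_ge0// sumr_ge0// => i _.
by rewrite conj_diag_entry sympd_ge0.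
Qed.

Lemma trace_conj_eq0 (Q : sym R n) (A : 'M[R]_n) : sympd Q ->
  \tr (A *m val Q *m A^T) = 0 -> A = 0.
Proof.
move=> pQ /eqP; rewrite psumr_eq0 => [/allP H|i _]; last first.
  by rewrite conj_diag_entry sympd_ge0.
apply/row_matrixP => i; rewrite row0; apply/eqP; apply: contraT => Ai.
have := H i; rewrite mem_index_enum => /(_ isT); rewrite conj_diag_entry.
by rewrite gt_eqF// pQ.
Qed.

(** In an eigenbasis of [Q] the equation multiplies the entry [(i, j)] by [d_i + d_j], which is
    positive. *)
Lemma lyapunov_inj (Q : sym R n) (X : 'M[R]_n) : sympd Q ->
  X *m val Q + val Q *m X = 0 -> X = 0.
Proof.
move=> pQ E; have [U [d [UU QE]]] := sym_diagonalization Q.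
have d0 := (sympd_diag UU QE).1 pQ; have UU' := mulmx1C UU.
have : U *m X *m U^T = 0.
  have : U *m (X *m val Q + val Q *m X) *m U^T = 0 by rewrite E mulmx0 mul0mx.
  rewrite QE mulmxDr mulmxDl !mulmxA UU mul1mx -!mulmxA UU mulmx1 !mulmxA.
  set Y := U *m X *m U^T => E'; apply/matrixP => i j; rewrite [RHS]mxE.
  have /eqP : Y i j * (d 0 j + d 0 i) = 0.
    transitivity ((Y *m diag_mx d + diag_mx d *m Y) i j).
      by rewrite [RHS]mxE mul_diagE diag_mulE mulrDr [d 0 i * _]mulrC.
    by rewrite /Y !mulmxA E' mxE.
  by rewrite mulf_eq0 [_ + _ == 0]gt_eqF ?addr_gt0// orbF => /eqP.
move=> /(congr1 (fun M => U^T *m M *m U)); rewrite mulmx0 mul0mx !mulmxA UU' mul1mx.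
by rewrite -mulmxA UU' mulmx1.
Qed.

End MatrixForms.

Section Procrustes.
Context {R : realType} {n : nat} (a : R).
Implicit Types P Q q x : sym R n.

Lemma anticomm_linear Q : linear (fun H : sym R n => anticomm H Q).
Proof.
move=> k x y; apply: val_inj; rewrite [RHS]linearP /=.
by rewrite mulmxDl mulmxDr -scalemxAl -scalemxAr scalerDr addrACA.
Qed.

Lemma anticomm_inj Q H : sympd Q -> anticomm H Q = 0 -> H = 0.
Proof.
by move=> pQ /(congr1 val) /= E; apply: val_inj; exact: lyapunov_inj pQ E.
Qed.

Lemma anticomm_injective Q H H' : sympd Q -> anticomm H Q = anticomm H' Q -> H = H'.
Proof.
move=> pQ HH; have := anticomm_linear Q (-1) H' H.
rewrite HH !scaleN1r addNr => /(anticomm_inj pQ)/eqP.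
by rewrite addrC subr_eq0 => /eqP.
Qed.

Lemma anticomm_surj Q : sympd Q -> forall y, exists H, anticomm H Q = y.
Proof.
move=> pQ; have [m [e [c ec]]] := @sym_coordinates R n.
apply: (linear_injective_surjective ec (anticomm_linear Q)) => H.
exact: anticomm_inj.
Qed.

Lemma sympd_sympow q : sympd q -> sympd (sympow q a).
Proof. by move=> pq; rewrite sympow_exp//; exact: sympd_symexp. Qed.

End Procrustes.

Section ProcrustesMetric.
Context {R : realType} {n : nat} (a : R).
Implicit Types P Q q x : sym R n.

Local Notation pow q := (sympow q (2 * a)).

(** The two differentials in the definition of [procrustes_L] are inverted, which leaves a Lyapunov
    equation; its solvability excludes the default value of the choice. *)
Lemma procrustes_LP q x : sympd q -> anticomm (procrustes_L a q x) (pow q) =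
  'd (@symexp R n) (symlog (pow q)) ('d (@symlog R n) q x).
Proof.
move=> pq; have pQ := sympd_sympow (2 * a) pq.
have [_ K1 K2] := symlog_differential pq; have [_ K3 K4] := symlog_differential pQ.
rewrite /procrustes_L; case: xgetP => [H _ /= <-|].
  exact: (esym (etrans (congr1 ('d (@symexp R n) (symlog (pow q))) (K1 _)) (K4 _))).
have [H HE] := anticomm_surj pQ
  ('d (@symexp R n) (symlog (pow q)) ('d (@symlog R n) q x)).
move=> /(_ H) /= []; rewrite HE.
exact: (etrans (congr1 ('d (@symexp R n) (symlog q)) (K3 _)) (K2 _)).
Qed.

Lemma sympow_smooth : smooth (@sympd R n) (fun q => pow q).
Proof.
have oS := @open_sympd R n; have [m [e [c ec]]] := @sym_coordinates R n.
move=> k; apply: (Ck_eq oS (f := fun q => symexp ((2 * a) *: symlog q))).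
  by move=> q pq; rewrite sympow_exp.
apply: (Ck_comp oS (U' := setT) ec (fun _ _ => I) _ (smooth_symexp k)).
exact: (Ck_scale oS (Ck_cst oS k (2 * a : R)) (smooth_symlog k)).
Qed.

(** Chain rule for [symexp ((2 * a) *: symlog q)]: up to the factor [2 * a], the derivative is the
    right-hand side of [procrustes_LP]. *)
Lemma derive_sympow q x : sympd q -> 'D_x (fun q => pow q) q =
  (2 * a) *: anticomm (procrustes_L a q x) (pow q).
Proof.
move=> pq; rewrite procrustes_LP//; have oS := @open_sympd R n.
have [dl _ _] := symlog_differential pq.
have dexp A : differentiable (@symexp R n) A by have [H _] := @smooth_symexp R n 1; exact: H.
pose L : {linear sym R n -> sym R n} := *:%R (2 * a).
have cL : continuous L by exact: linear_continuous_sym.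
have [dL DL] := derive_linear cL dl.
have dc := differentiable_comp dL (dexp (L (symlog q))).
have -> : symlog (pow q) = (2 * a) *: symlog q by rewrite sympow_exp// symexpK.
transitivity ('D_x (@symexp R n \o (fun q => L (symlog q))) q).
  apply: near_eq_derive; apply: (open_near oS pq) => p pp.
  by rewrite sympow_exp.
have E : 'd (fun q => L (symlog q)) q x = (2 * a) *: 'd (@symlog R n) q x.
  exact: (etrans (esym (deriveE x dL)) (etrans (DL x) (congr1 L (deriveE x dl)))).
apply: (etrans (deriveE x dc)).
apply: (etrans (congr1 (fun F : sym R n -> sym R n => F x)
  (diff_comp dL (dexp (L (symlog q)))))).
apply: (etrans (congr1 ('d (@symexp R n) (L (symlog q))) E)).
exact: linearZ.
Qed.

Lemma procrustes_L_linear q : sympd q -> linear (procrustes_L a q).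
Proof.
move=> pq k x y; have pQ := sympd_sympow (2 * a) pq.
apply: (anticomm_injective pQ).
have E z := procrustes_LP z pq.
apply: (etrans (E _)); apply: etrans (esym (anticomm_linear (pow q) k _ _)).
apply: (etrans (congr1 ('d (@symexp R n) (symlog (pow q))) (linearP _ k x y))).
apply: (etrans (linearP _ k _ _)).
by congr (_ *: _ + _); exact: esym (E _).
Qed.

Lemma anticommE (H Q : sym R n) :
  anticomm H Q = sym_proj (val H *m val Q + val Q *m val H).
Proof. by rewrite -[LHS]sym_projK. Qed.

Hypothesis a0 : a != 0.

Let a20 : 2 * a != 0.
Proof. by rewrite mulf_neq0// pnatr_eq0. Qed.

(** Cramer's rule for the Lyapunov equation scaled by [2 * a], nonzero by assumption. Scaled in this
    way, its right-hand side is a directional derivative of the smooth map [pow]. *)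
Lemma procrustes_L_smooth x : smooth (@sympd R n) (fun q => procrustes_L a q x).
Proof.
have oS := @open_sympd R n; have [m [e [c ec]]] := @sym_coordinates R n.
have cL : continuous (vsval : {linear sym R n -> 'M[R]_n}) by exact: linear_continuous_sym.
have cP : continuous (@sym_proj R n) by exact: linear_continuous_mx.
move=> k.
have cpow : Ck k (@sympd R n) (fun q => val (pow q)).
  by apply: (Ck_linear oS cL); exact: sympow_smooth.
apply: (Ck_solve oS (A := fun q H => (2 * a) *: anticomm H (pow q))
  (F := fun q => 'D_x (fun q => pow q) q) ec).
- move=> q _ l H H'; rewrite (anticomm_linear (pow q) l H H') scalerDr.
  by rewrite !scalerA mulrC.
- move=> q H pq /eqP; rewrite scaler_eq0 (negbTE a20) => /eqP.
  by apply: anticomm_inj; exact: sympd_sympow.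
- move=> j; apply: (Ck_scale oS (Ck_cst oS k (2 * a : R))).
  apply: (Ck_eq oS (f := fun q => sym_proj (val (e j) *m val (pow q) + val (pow q) *m val (e j)))).
    by move=> q _; rewrite anticommE.
  apply: (Ck_linear oS cP); apply: (CkD oS).
    exact: (Ck_mulmx oS (Ck_cst oS _ _) cpow).
  exact: (Ck_mulmx oS cpow (Ck_cst oS _ _)).
- by have [_ H] := sympow_smooth k.+1; exact: H.
- by move=> q pq; rewrite derive_sympow.
Qed.

End ProcrustesMetric.

(** * The optimal transport map from the covariance at [P] *)

Section Transport.
Context {R : realType} {n : nat} (a : R).
Implicit Types P Q S X q x : sym R n.

Local Notation pow q := (sympow q (2 * a)).

Definition conj_sym S X : sym R n := sym_proj (val S *m val X *m val S).

Lemma val_conj_sym S X : val (conj_sym S X) = val S *m val X *m val S.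
Proof.
by apply: vsprojK; apply/symspaceP; rewrite !trmx_mul !val_symT mulmxA.
Qed.

Fact conj_sym_linear S : linear (conj_sym S).
Proof.
move=> k x y; apply: val_inj; rewrite [RHS]linearP /= !val_conj_sym.
by rewrite /= mulmxDr mulmxDl -scalemxAr -scalemxAl.
Qed.

HB.instance Definition _ S :=
  GRing.isLinear.Build R (sym R n) (sym R n) _ (conj_sym S) (conj_sym_linear S).

Lemma symexp0 X : val (symexp (0 *: X)) = 1%:M.
Proof.
have [U [d [UU XE]]] := sym_diagonalization X.
have E : val (0 *: X) = U^T *m diag_mx (0 : 'rV[R]_n) *m U.
  by rewrite scale0r [LHS]linear0 linear0 mulmx0 mul0mx.
rewrite (spectral_funE _ UU E); have -> : map_mx expR (0 : 'rV[R]_n) = const_mx 1.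
  by apply/rowP => i; rewrite !mxE expR0.
by rewrite diag_const_mx mulmx1 (mulmx1C UU).
Qed.

(** The positive definite square root of [pow P], and below it the inverse of that root. *)
Definition root P := symexp (a *: symlog P).
Definition iroot P := symexp (- a *: symlog P).

Lemma rootK P : val (iroot P) *m val (root P) = 1%:M.
Proof. by rewrite symexp_mul addNr symexp0. Qed.

Lemma irootK P : val (root P) *m val (iroot P) = 1%:M.
Proof. by rewrite symexp_mul subrr symexp0. Qed.

Lemma root_sqr P : sympd P -> val (root P) *m val (root P) = val (pow P).
Proof.
move=> pP; apply: (etrans (symexp_mul (symlog P) a a)).
have -> : a + a = 2 * a by rewrite mulr_natl.
exact: (congr1 val (esym (sympow_exp (2 * a) pP))).
Qed.

Lemma sympd_conj P Q : sympd Q -> sympd (conj_sym (root P) Q).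
Proof.
move=> pQ x x0; rewrite val_conj_sym !mulmxA -mulmxA.
have -> : val (root P) *m x^T = (x *m val (root P))^T by rewrite trmx_mul val_symT.
apply: pQ; apply: contra x0 => /eqP xr.
by rewrite -[x]mulmx1 -(irootK P) mulmxA xr mul0mx.
Qed.

(* The optimal transport map between the centred Gaussian measures of covariance
   [pow P] and [pow q]. *)
Definition transport P q : sym R n :=
  conj_sym (iroot P) (symexp (2^-1 *: symlog (conj_sym (root P) (pow q)))).

(** With [S = Q0^(1/2)] and [r = (S Q S)^(1/2)], this is the verification that
    [Q0^(-1/2) r Q0^(-1/2)] transports [Q0] to [Q]. *)
Lemma sandwich_mx (S Si r Q : 'M[R]_n) : S *m Si = 1%:M -> Si *m S = 1%:M ->
  r *m r = S *m Q *m S -> (Si *m r *m Si) *m (S *m S) *m (Si *m r *m Si) = Q.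
Proof.
move=> E1 E2 rr; rewrite !mulmxA -(mulmxA _ Si S) E2 mulmx1.
rewrite -(mulmxA _ S Si) E1 mulmx1 -(mulmxA _ r r) rr !mulmxA E2 mul1mx.
by rewrite -(mulmxA _ S Si) E1 mulmx1.
Qed.

Lemma transportP P q : sympd P -> sympd q ->
  val (transport P q) *m val (pow P) *m val (transport P q) = val (pow q).
Proof.
move=> pP pq; rewrite /transport val_conj_sym.
set Z := conj_sym (root P) (pow q); set r := val (symexp _).
have pZ : sympd Z by apply: sympd_conj; exact: sympd_sympow.
have rr : r *m r = val (root P) *m val (pow q) *m val (root P).
  rewrite -val_conj_sym -/Z /r symexp_mul.
  have -> : 2^-1 + 2^-1 = 1 :> R by rewrite [RHS]splitr mul1r.
  by rewrite scale1r symlogK.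
apply: (etrans (congr1 (fun M => _ *m M *m _) (esym (root_sqr pP)))).
exact: (sandwich_mx (irootK P) (rootK P) rr).
Qed.

Lemma transport_id P : sympd P -> val (transport P P) = 1%:M.
Proof.
move=> pP; rewrite /transport val_conj_sym.
(* At [q = P] all factors are powers of [P] and exponents add: [a + 2 a + a = 4 a] here, and
   [- a + 2 a - a = 0] at the end. *)
have -> : conj_sym (root P) (pow P) = symexp ((4 * a) *: symlog P).
  apply: val_inj; rewrite val_conj_sym -(root_sqr pP) /root !symexp_mul.
  congr (val (symexp (_ *: _))); ring.
rewrite symexpK scalerA /iroot !symexp_mul.
have -> : - a + 2^-1 * (4 * a) + - a = 0 by field.
exact: symexp0.
Qed.

Lemma transport_smooth P : sympd P -> smooth (@sympd R n) (transport P).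
Proof.
move=> pP k; have oS := @open_sympd R n; have [m [e [c ec]]] := @sym_coordinates R n.
have cS S : continuous (conj_sym S) by exact: linear_continuous_sym.
apply: (Ck_linear oS (cS (iroot P))).
have cZ : Ck k (@sympd R n) (fun q => conj_sym (root P) (pow q)).
  exact: (Ck_linear oS (cS (root P)) (sympow_smooth _ k)).
have clog : Ck k (@sympd R n) (fun q => symlog (conj_sym (root P) (pow q))).
  apply: (Ck_comp oS ec _ cZ (smooth_symlog k)) => q pq.
  by apply: sympd_conj; exact: sympd_sympow.
exact: (Ck_comp oS (U' := setT) ec (fun _ _ => I)
  (Ck_scale oS (Ck_cst oS k (2^-1 : R)) clog) (smooth_symexp k)).
Qed.

End Transport.

Lemma trace_form_orthogonal (R : realType) n (k : R) (Q N N' K K' : 'M[R]_n) : Q^T = Q ->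
  trace_form k Q N K' = 0 -> trace_form k Q N' K = 0 ->
  trace_form k Q (N + K) (N' + K') - trace_form k Q N N' = trace_form k Q K K'.
Proof.
move=> QT NK NK'; rewrite linearDl !linearDr /= NK (trace_formC _ K N' QT) NK'.
by rewrite addr0 add0r addrAC subrr add0r.
Qed.

Lemma trmx_symmetrized (R : realType) n (A C A' C' K L : 'M[R]_n) :
  A^T = A -> C^T = C -> A'^T = A' -> C'^T = C' -> K^T = K -> L^T = L ->
  (A - C - K *m L + (A' - C' - L *m K))^T = A - C - K *m L + (A' - C' - L *m K).
Proof.
move=> AT CT AT' CT' KT LT; rewrite !raddfD !raddfN /= !trmx_mul AT CT AT' CT' KT LT.
by rewrite addrACA [RHS]addrACA; congr (_ + _); exact: addrC.
Qed.

Lemma lyapunov_symmetrized (R : realType) n (A B Q : 'M[R]_n) : (A + B)^T = A + B ->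
  A *m Q + Q *m A^T = 0 -> B *m Q + Q *m B^T = 0 -> (A + B) *m Q + Q *m (A + B) = 0.
Proof.
move=> ABT QA QB; rewrite -{2}ABT raddfD /= mulmxDl mulmxDr addrACA QA QB.
exact: addr0.
Qed.

(** * The alpha-Procrustes metric as a flat metric minus a square *)

Section AlphaProcrustes.
Context {R : realType} {n : nat} (a : R) (P : sym R n).
Hypotheses (a0 : a != 0) (pP : sympd P).
Implicit Types q x y z u v : sym R n.

Let Q q := val (sympow q (2 * a)).
Let T q := val (transport a P q).
(** The factor [2 * a] yields [D_x Q = K Q + Q K]; it also turns [4 tr (L Q L)] into
    [a ^- 2 * tr (K Q K)], whence the constant of the trace form. *)
Let K q x := (2 * a) *: val (procrustes_L a q x).
Let oS := @open_sympd R n.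

Let N q x : 'M[R]_n := 'D_x T q - K q x *m T q.

Let cval : continuous (vsval : {linear sym R n -> 'M[R]_n}).
Proof. exact: linear_continuous_sym. Qed.

Let Qsym q : (Q q)^T = Q q. Proof. exact: val_symT. Qed.
Let Tsym q : (T q)^T = T q. Proof. exact: val_symT. Qed.
Let Ksym q x : (K q x)^T = K q x. Proof. by rewrite /K linearZ/= val_symT. Qed.

Let T_smooth : smooth (@sympd R n) T.
Proof. by move=> k; apply: (Ck_linear oS cval); exact: transport_smooth. Qed.

Let K_smooth x : smooth (@sympd R n) (fun q => K q x).
Proof.
move=> k; apply: (Ck_scale oS (Ck_cst oS k (2 * a : R))).
by apply: (Ck_linear oS cval); exact: procrustes_L_smooth.
Qed.

Let DT_smooth x : smooth (@sympd R n) (fun q => 'D_x T q).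
Proof. by move=> k; have [_ H] := T_smooth k.+1; exact: H. Qed.

Let N_smooth x : smooth (@sympd R n) (fun q => N q x).
Proof.
move=> k; apply: (CkB oS (DT_smooth x k)).
exact: (Ck_mulmx oS (K_smooth x k) (T_smooth k)).
Qed.

Let smooth_differentiable (W : normedModType R) (f : sym R n -> W) q :
  smooth (@sympd R n) f -> sympd q -> differentiable f q.
Proof. by move=> sf pq; have [H _] := sf 1; exact: H. Qed.

Let DTE x q : sympd q -> 'D_x T q = val ('D_x (transport a P) q).
Proof.
move=> pq; have dt : differentiable (transport a P) q.
  by apply: smooth_differentiable pq; exact: transport_smooth.
by have [_ ->] := derive_linear cval dt.
Qed.

Let DTsym x q : sympd q -> ('D_x T q)^T = 'D_x T q.
Proof. by move=> pq; rewrite DTE// val_symT. Qed.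

Let TQT q : sympd q -> T q *m Q P *m T q = Q q.
Proof. exact: transportP. Qed.

Let DQ x q : sympd q -> 'D_x Q q = K q x *m Q q + Q q *m K q x.
Proof.
move=> pq; have dQ : differentiable (fun q => sympow q (2 * a)) q.
  by apply: smooth_differentiable pq; exact: sympow_smooth.
have [_ ->] := derive_linear cval dQ.
by rewrite derive_sympow// linearZ/= scalerDr scalemxAl scalemxAr.
Qed.

(** Differentiate [T Q0 T = Q] in direction [x] and subtract [D_x Q = K Q + Q K], in which
    [K Q = (K T) Q0 T]. *)
Let N_skew_mx q x : sympd q ->
  N q x *m Q P *m T q + T q *m Q P *m (N q x)^T = 0.
Proof.
move=> pq; have dT := smooth_differentiable T_smooth pq.
have [dTQ DTQ] := derive_mulmx dT (differentiable_cst (Q P) q).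
have [_ DTQT] := derive_mulmx dTQ dT.
have E : 'D_x T q *m Q P *m T q + T q *m Q P *m 'D_x T q = K q x *m Q q + Q q *m K q x.
  rewrite -DQ//; transitivity ('D_x (fun q => T q *m Q P *m T q) q).
    by rewrite DTQT DTQ derive_cst mulmx0 addr0.
  by apply: near_eq_derive; apply: (open_near oS pq) => q' pq'; exact: TQT.
rewrite /N [(_ - _)^T]linearB/= trmx_mul DTsym// Tsym Ksym.
have E1 : K q x *m T q *m Q P *m T q = K q x *m Q q by rewrite -[in RHS](TQT pq) !mulmxA.
have E2 : T q *m Q P *m (T q *m K q x) = Q q *m K q x by rewrite -[in RHS](TQT pq) !mulmxA.
by rewrite !mulmxBl mulmxBr addrACA E E1 E2 -opprD subrr.
Qed.

(** Pythagoras for [D_x T = N x + K x * T]: pairing [N z] with [k * T], [k] symmetric, gives the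
    trace of a skew matrix times [k], which is zero. *)
Let metricE q x y : sympd q -> alpha_procrustes a q x y =
  trace_form (a ^- 2) (Q P) ('D_x T q) ('D_y T q)
  - trace_form (a ^- 2) (Q P) (N q x) (N q y).
Proof.
move=> pq.
have b0 z (k : 'M[R]_n) : k^T = k -> trace_form (a ^- 2) (Q P) (N q z) (k *m T q) = 0.
  move=> kT; rewrite /trace_form trmx_mul Tsym kT.
  have /eqP := N_skew_mx z pq; rewrite addr_eq0 => /eqP skew.
  suff -> : \tr (N q z *m Q P *m (T q *m k)) = 0 by rewrite mulr0.
  rewrite mulmxA; set A := N q z *m Q P *m T q in skew *.
  have AT : A^T = - A.
    by rewrite [in RHS]skew opprK /A !trmx_mul Tsym Qsym mulmxA.
  have : \tr (A *m k) = - \tr (A *m k).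
    by rewrite -{1}mxtrace_tr trmx_mul kT AT mulmxN linearN mxtrace_mulC.
  lra.
have DE z : 'D_z T q = N q z + K q z *m T q by rewrite /N subrK.
rewrite !DE (trace_form_orthogonal (Qsym P) (b0 x _ (Ksym q y)) (b0 y _ (Ksym q x))).
rewrite /trace_form trmx_mul Tsym Ksym.
have -> : K q x *m T q *m Q P *m (T q *m K q y) = K q x *m Q q *m K q y.
  by rewrite -[in RHS](TQT pq) !mulmxA.
rewrite /alpha_procrustes /K -!scalemxAl -scalemxAr scalerA linearZ/= mulrA; congr (_ * _).
by field.
Qed.

Let K0 q x : sympd q -> K q x = 0 -> x = 0.
Proof.
move=> pq /eqP; rewrite scaler_eq0 mulf_eq0 pnatr_eq0 (negbTE a0)/= => /eqP H0.
have {}H0 : procrustes_L a q x = 0 by apply: val_inj; rewrite /= H0.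
have [_ K1 K2] := symlog_differential pq.
have [_ K3 K4] := symlog_differential (sympd_sympow (2 * a) pq).
have := procrustes_LP a x pq; rewrite H0 => E.
apply: (can_inj K2); rewrite [RHS]linear0; apply: (can_inj K3); rewrite [RHS]linear0 -E.
by apply: val_inj; rewrite /= !(mul0mx, mulmx0) addr0.
Qed.

Let metric_nondegenerate q w : sympd q ->
  (forall z, alpha_procrustes a q w z = 0) -> w = 0.
Proof.
move=> pq /(_ w) /eqP; rewrite /alpha_procrustes mulf_eq0 pnatr_eq0/= => /eqP E.
have H0 : val (procrustes_L a q w) = 0.
  by apply: (trace_conj_eq0 (sympd_sympow (2 * a) pq)); rewrite val_symT.
by apply: (K0 pq); rewrite /K H0 scaler0.
Qed.

Let T1 : T P = 1%:M. Proof. exact: transport_id. Qed.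

Let N0 x : N P x = 0.
Proof.
have pQ : sympd (sympow P (2 * a)) by exact: sympd_sympow.
have NT : (N P x)^T = N P x by rewrite /N T1 mulmx1 linearB/= DTsym// Ksym.
by apply: (lyapunov_inj pQ); have := N_skew_mx x pP; rewrite T1 mulmx1 mul1mx NT.
Qed.

Let DT_K x : 'D_x T P = K P x.
Proof. by have /eqP := N0 x; rewrite /N T1 mulmx1 subr_eq0 => /eqP. Qed.

Let derive_trmx (f : sym R n -> 'M[R]_n) w : differentiable f P ->
  differentiable (fun q => (f q)^T) P /\ 'D_w (fun q => (f q)^T) P = ('D_w f P)^T.
Proof.
move=> df; have ct : continuous (trmx : {linear 'M[R]_n -> 'M[R]_n}).
  exact: linear_continuous_mx.
by have [d D] := derive_linear ct df; split=> //; exact: D.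
Qed.

Let derive_sym (f : sym R n -> 'M[R]_n) w : differentiable f P ->
  (forall q, sympd q -> (f q)^T = f q) -> ('D_w f P)^T = 'D_w f P.
Proof.
move=> df fT; have [_ <-] := derive_trmx w df.
by apply: near_eq_derive; apply: (open_near oS pP) => q pq; rewrite fT.
Qed.

(** Differentiating the skew relation at [P], where [N = 0] and [T = 1], gives [B Q0 + Q0 B^T = 0]
    for each [B = D_w (N z)]. There [B] equals [D_w D_z T - D_w K_z - K_z K_w], whose only
    nonsymmetric part is the product; it becomes symmetric on adding the term with [w] and [z]
    exchanged, and [lyapunov_inj] applies to the sum. *)
Let N_skew u v : 'D_u (fun q => N q v) P = - 'D_v (fun q => N q u) P.
Proof.
apply/eqP; rewrite -addr_eq0; apply/eqP.
have dN z := smooth_differentiable (N_smooth z) pP.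
have dT := smooth_differentiable T_smooth pP.
have dK z := smooth_differentiable (K_smooth z) pP.
have dDT z := smooth_differentiable (DT_smooth z) pP.
pose B w z := 'D_w (fun q => N q z) P; rewrite -/(B u v) -/(B v u).
have skew w z : B w z *m Q P + Q P *m (B w z)^T = 0.
  have [dNQ DNQ] := derive_mulmx (dN z) (differentiable_cst (Q P) P).
  have [dA DA] := derive_mulmx dNQ dT.
  have [dAT DAT] := derive_trmx w dA.
  have DAP : 'D_w (fun q => N q z *m Q P *m T q) P = B w z *m Q P.
    by rewrite DA DNQ derive_cst N0 T1 mulmx1 ?mul0mx ?mulmx0 ?mul0mx !addr0.
  have <- : (B w z *m Q P)^T = Q P *m (B w z)^T by rewrite trmx_mul Qsym.
  rewrite -DAP -DAT -(deriveD (diff_derivable dA) (diff_derivable dAT)).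
  rewrite -(derive_cst (0 : 'M[R]_n) P w); apply: near_eq_derive.
  apply: (open_near oS pP) => q pq; rewrite -[RHS](N_skew_mx z pq).
  by congr (_ + _); rewrite !trmx_mul Tsym Qsym mulmxA.
have symB w z : B w z =
    'D_w (fun q => 'D_z T q) P - 'D_w (fun q => K q z) P - K P z *m K P w.
  have [dKT DKT] := derive_mulmx (dK z) dT.
  rewrite /B (deriveB (diff_derivable (dDT z)) (diff_derivable dKT)).
  by rewrite DKT T1 mulmx1 DT_K opprD addrA.
have DDT w z : ('D_w (fun q => 'D_z T q) P)^T = 'D_w (fun q => 'D_z T q) P.
  by apply: derive_sym (dDT z) _ => q pq; exact: DTsym.
have DK w z : ('D_w (fun q => K q z) P)^T = 'D_w (fun q => K q z) P.
  by apply: derive_sym (dK z) _ => q pq; exact: Ksym.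
have YT : (B u v + B v u)^T = B u v + B v u.
  rewrite (symB u v) (symB v u).
  exact: (trmx_symmetrized (DDT u v) (DK u v) (DDT v u) (DK v u) (Ksym P v) (Ksym P u)).
have pQ : sympd (sympow P (2 * a)) by exact: sympd_sympow.
exact: (lyapunov_inj pQ (lyapunov_symmetrized YT (skew u v) (skew v u))).
Qed.

(** The transport map takes values in the symmetric matrices, so its differential at [P] is an
    endomorphism of that space. It is [K], hence injective, hence onto, and [D_u D_v T] is
    symmetric. *)
Let T_surj u v : exists x, 'D_x T P = 'D_u (fun q => 'D_v T q) P.
Proof.
have [m [e [c ec]]] := @sym_coordinates R n.
have dt : differentiable (transport a P) P.
  by apply: smooth_differentiable pP; exact: transport_smooth.
have lin : linear (fun x => 'D_x (transport a P) P).
  by move=> k x y; rewrite !deriveE// linearP.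
have inj x : 'D_x (transport a P) P = 0 -> x = 0.
  by move=> Dx; apply: (K0 pP); rewrite -DT_K DTE// Dx linear0.
have [x Dx] := linear_injective_surjective ec lin inj
  ('D_u (fun q => 'D_v (transport a P) q) P).
exists x; rewrite DTE// Dx.
have dDt : differentiable (fun q => 'D_v (transport a P) q) P.
  by have [_ /(_ v) [H _]] := transport_smooth a pP 2; exact: H.
have [_ <-] := derive_linear cval dDt.
by apply: near_eq_derive; apply: (open_near oS pP) => q pq; rewrite DTE.
Qed.

Lemma alpha_procrustes_sectional_curvature_ge0 u v :
  0 <= sectional_curvature (@alpha_procrustes R n a) P u v.
Proof.
have [m [e [c ec]]] := @sym_coordinates R n.
have [mM [eM [cM ecM]]] := @mx_coordinates R n.
apply: (sectional_curvature_ge0 (b := trace_form (a ^- 2) (Q P)) (T := T) (N := N)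
  ec ecM oS) => //.
- exact: trace_form_continuous.
- by move=> x y; exact: trace_formC.
- move=> x; apply: trace_form_ge0; first by rewrite invr_ge0 sqr_ge0.
  exact: sympd_sympow.
- by move=> x; exact: N_smooth.
- move=> q pq k x y; have dT := smooth_differentiable T_smooth pq.
  have DL : 'D_(k *: x + y) T q = k *: 'D_x T q + 'D_y T q.
    by rewrite !(deriveE _ dT) linearP.
  have KL : K q (k *: x + y) = k *: K q x + K q y.
    apply: (etrans (congr1 (fun H => (2 * a) *: val H) (procrustes_L_linear a pq k x y))).
    by rewrite /= scalerDr /K !scalerA mulrC.
  have mxE (D D' A A' B : 'M[R]_n) :
      k *: D + D' - (k *: A + A') *m B = k *: (D - A *m B) + (D' - A' *m B).
    by rewrite mulmxDl -scalemxAl scalerBr opprD addrACA.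
  by rewrite /N DL KL; exact: mxE.
Qed.

End AlphaProcrustes.

Theorem proposition7 (R : realType) (n : nat) (alpha : R) (halpha : alpha != 0)
    (P : sym R n) (hP : sympd P)
    (sigma : {vspace (sym R n)}) (hsigma : (\dim sigma = 2)%N)
    (u v : sym R n) (huv : sigma = <<[:: u; v]>>%VS) :
  0 <= sectional_curvature (@alpha_procrustes R n alpha) P u v.
Proof. exact: alpha_procrustes_sectional_curvature_ge0. Qed.
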